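(* Let $C = \big(7\sqrt{2} + 4 + 3\log(\sqrt{2}+1)\big)/(3\pi^2)$. The probability that a matrix chosen uniformly at random from $\mathcal{M}_2(k)$ has integer eigenvalues is asymptotic to $C(\log k)/k$ as $k\to\infty$. More precisely, \[ |\mathcal{M}^{\mathbb{Z}}_2(k)| = 16\,C\,k^3 \log k + O(k^3). \]
   Context: For an integer $k\ge1$, $\mathcal{M}_2(k)$ denotes the set of $2\times2$ matrices all of whose entries are integers of absolute value at most $k$, regarded as a uniform probability space. For an integer $\lambda$, $\mathcal{M}^\lambda_2(k) = \{M\in\mathcal{M}_2(k) : \lambda \text{ is an eigenvalue of } M\}$, and $\mathcal{M}^{\mathbb{Z}}_2(k)=\bigcup_{\lambda\in\mathbb{Z}}\mathcal{M}^\lambda_2(k)$. Here $\log$ is the natural logarithm. *)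

(* Defs.v *)
From HB Require Import structures.
From mathcomp Require Import all_boot all_order all_algebra.
From mathcomp Require Import finmap.
From mathcomp Require Import all_classical all_reals all_analysis.

Set Implicit Arguments.
Unset Strict Implicit.
Unset Printing Implicit Defensive.

Import Order.TTheory GRing.Theory Num.Theory.
Import numFieldNormedType.Exports.

Local Open Scope classical_set_scope.
Local Open Scope ring_scope.

Definition intmx2 (k : nat) : set 'M[int]_2 :=
  [set M | forall i j, `|M i j| <= k%:Z].

(* [eigenvalue] requires coefficients in a field, so M is mapped to rat. It is
   defined through row vectors: v *m M = lam *: v for some v != 0. *)
Definition int_eigenvalue (M : 'M[int]_2) (lam : int) : bool :=
  eigenvalue (map_mx intr M : 'M[rat]_2) lam%:~R.

Definition intmx2_eig (lam : int) (k : nat) : set 'M[int]_2 :=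
  [set M | intmx2 k M /\ int_eigenvalue M lam].

Definition intmx2_inteig (k : nat) : set 'M[int]_2 :=
  \bigcup_(lam in [set: int]) intmx2_eig lam k.

(* [fset_set A] is [fset0] when A is infinite; [finite_intmx2] and
   [finite_intmx2_inteig] below show that this junk value is never used. *)
Definition ncard (T : choiceType) (A : set T) : nat := #|` fset_set A |%fset.

Definition fin_uniform_prob (R : realType) (T : choiceType) (A E : set T) : R :=
  (ncard (A `&` E))%:R / (ncard A)%:R.

Definition eigC (R : realType) : R :=
  (7 * Num.sqrt 2 + 4 + 3 * ln (Num.sqrt 2 + 1)) / (3 * pi ^+ 2).

Lemma finite_intmx2 (k : nat) : finite_set (intmx2 k).
Proof.
pose f (N : 'M['I_(k + k).+1]_2) : 'M[int]_2 :=
  map_mx (fun i : 'I__ => (nat_of_ord i)%:Z - k%:Z) N.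
apply: (@sub_finite_set _ _ (f @` setT)); last exact/finite_image/finite_finset.
move=> M /= Mk; exists (map_mx (fun z : int => inord (absz (z + k%:Z))) M) => //.
apply/matrixP => i j; rewrite !mxE.
have := Mk i j; rewrite ler_norml => /andP[lo hi].
have ge0 : 0 <= M i j + k%:Z by rewrite -lerBlDr sub0r.
rewrite inordK; first by rewrite gez0_abs// addrK.
by rewrite ltnS -lez_nat gez0_abs// PoszD lerD2r.
Qed.

Lemma finite_intmx2_inteig (k : nat) : finite_set (intmx2_inteig k).
Proof.
by apply: sub_finite_set (finite_intmx2 k) => M [lam _ []].
Qed.

(* Main.v *)
(** A matrix with rows (a, b), (c, d) has the eigenvalue l iff (a - l)(d - l) = bc,
    and, except for O(k^3) matrices with a double eigenvalue, it has two integer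
    eigenvalues as soon as it has one. Twice the count is thus, up to O(k^3), the number
    of solutions of bc = xy with |b|, |c| <= k and |x + l|, |y + l| <= k, summed over |l| <= 2k.
    Apart from O(k^3) degenerate ones, and up to symmetries, a solution is uniquely
    (b, x, y, c) = (mu, mv, nu, nv) with u > v >= 1 coprime. For fixed u, v, l the
    integers m and n range over intervals of lengths (k/u) len1(l/k, v/u) and
    (k/u) len2(l/k, v/u), and summing over l gives k^3 J(v/u)/u^2 where J(r) is the
    integral of len1 len2. Hence the count is 4 k^3 A(k) + O(k^3), where A(n) is the
    sum of J(v/u)/u^2 over coprime v < u <= n.

    Without the coprimality condition this sum is (int_0^1 J) log n + O(1), and
    grouping by gcds it equals the sum of A(n/m)/m^2 over m <= n. As the 1/m^2 with
    m >= 2 add up to less than 1, an induction on n turns this into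
    A(n) = (int_0^1 J)/zeta(2) log n + O(1), with no Moebius inversion. The value of
    zeta(2) comes from 4/sin(2x)^2 = 1/sin(x)^2 + 1/cos(x)^2 (Hofbauer). *)

Require Import Defs.
From HB Require Import structures.
From mathcomp Require Import all_boot all_order all_algebra.
From mathcomp Require Import finmap.
From mathcomp Require Import all_classical all_reals all_analysis.
From mathcomp Require Import zify ring lra.

Set Implicit Arguments.
Unset Strict Implicit.
Unset Printing Implicit Defensive.

Import Order.TTheory GRing.Theory Num.Theory.
Import numFieldNormedType.Exports.

Local Open Scope classical_set_scope.
Local Open Scope ring_scope.

(** * Solutions of bc = xy *)

Section NatSums.
Local Open Scope nat_scope.

Lemma sum_multiples (V : nmodType) (m k : nat) (G : nat -> V) : 0 < m ->
  (\sum_(1 <= b < k.+1 | (m %| b)%N) G b = \sum_(1 <= u < (k %/ m)%N.+1) G (m * u)%N)%R.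
Proof.
move=> m0; elim: k => [|k IH]; first by rewrite div0n !big_nil.
rewrite divnS// big_mkcond big_nat_recr//= -big_mkcond IH.
case: ifPn => dv; last by rewrite add0n addr0.
rewrite [RHS]big_nat_recr//=; congr (_ + G _)%R.
by rewrite add1n -[(k %/ m).+1]add1n; move: (divnS k m0); rewrite dv => <-;
  rewrite mulnC divnK.
Qed.

(** Each pair is written once as (m u, m v), where m is its gcd. The same regrouping serves the
    solutions of bc = xy and the sum of [J]. *)
Lemma sum_by_gcd (V : nmodType) (k : nat) (F : nat -> nat -> V) :
  (\sum_(1 <= b < k.+1) \sum_(1 <= x < b) F b x =
   \sum_(1 <= m < k.+1) \sum_(1 <= u < (k %/ m)%N.+1)
      \sum_(1 <= v < u | coprime u v) F (m * u)%N (m * v)%N)%R.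
Proof.
transitivity (\sum_(1 <= m < k.+1) \sum_(1 <= b < k.+1)
  \sum_(1 <= x < b | gcdn b x == m) F b x)%R.
  rewrite exchange_big/=; apply: eq_big_nat => b /andP[b0 bk].
  under [RHS]eq_bigr do rewrite big_mkcond/=.
  rewrite exchange_big/=; apply: eq_big_nat => x /andP[x0 xb].
  rewrite -big_mkcond/= (big_rem (gcdn b x))/=; last first.
    rewrite mem_index_iota gcdn_gt0 b0/= (leq_ltn_trans _ bk)//.
    by rewrite dvdn_leq// dvdn_gcdl.
  rewrite eqxx big1_seq ?addr0// => i /andP[/eqP <-].
  by rewrite rem_filter ?iota_uniq// mem_filter/= eqxx.
apply: eq_big_nat => m /andP[m0 mk].
transitivity (\sum_(1 <= b < k.+1 | (m %| b)%N)
   \sum_(1 <= v < (b %/ m)%N | coprime (b %/ m) v) F b (m * v)%N)%R; last first.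
  by rewrite sum_multiples//; apply: eq_bigr => u _; rewrite mulKn.
rewrite [RHS]big_mkcond/=; apply: eq_big_nat => b /andP[b0 bk].
case: ifPn => [mb|nmb]; last first.
  rewrite big1// => x /eqP gm; case/negP: nmb; rewrite -gm; exact: dvdn_gcdl.
have /dvdnP[u ub] := mb; have {}ub : b = m * u by rewrite mulnC.
subst b; rewrite mulKn//.
have u0 : 0 < u by rewrite muln_gt0 in b0; case/andP: b0.
rewrite (eq_bigl (fun x => (m %| x) && (gcdn (m * u) x == m))); last first.
  move=> x; case: eqP => [gm|_]; last by rewrite andbF.
  by rewrite andbT; apply/esym; rewrite -gm dvdn_gcdr.
rewrite big_mkcondr/= -{1}[m * u](@prednK); last by rewrite muln_gt0 m0.
rewrite sum_multiples//.
have -> : ((m * u).-1 %/ m).+1 = u.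
  rewrite -{2}(mulKn u m0) -{2}[m * u](@prednK) ?muln_gt0 ?m0//.
  rewrite divnS// (@prednK (m * u)) ?muln_gt0 ?m0// dvdn_mulr//.
rewrite [RHS]big_mkcond/=; apply: eq_bigr => v _.
by rewrite -muln_gcdr /coprime -{2}[m]muln1 eqn_pmul2l.
Qed.

Lemma sum_leq_mul (q v t : nat) : 0 < v ->
  \sum_(1 <= m < q.+1) (m * v <= t) = minn q (t %/ v).
Proof.
move=> v0; elim: q => [|q IH]; first by rewrite big_nil min0n.
rewrite big_nat_recr//= IH -leq_divRL//; move: (t %/ v) => d; clear IH; lia.
Qed.

(* The number of signs e with [|e x + l| <= k]. *)
Definition sign_count (k l x : nat) : nat := (x + l <= k) + ((l <= x + k) && (x <= l + k)).

Lemma sign_count_le2 k l x : sign_count k l x <= 2.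
Proof. by rewrite /sign_count; case: (_ <= k); case: (l <= _); case: (x <= _). Qed.

Definition quad_weight k l b x c y :=
  (b * c == x * y) * (sign_count k l x * sign_count k l y).

(** For l <= 2 k the bound 3 k loses nothing, as |x + l| <= k or |-x + l| <= k forces x <= 3 k. Only
    positive values occur; the signs of x and y are left to [sign_count]. *)
Definition quad_sum k l := \sum_(1 <= b < k.+1) \sum_(1 <= x < (3 * k).+1)
  \sum_(1 <= c < k.+1) \sum_(1 <= y < (3 * k).+1) quad_weight k l b x c y.

(* The part [x < b] of [quad_sum], through (b, x, y, c) = (m u, m v, n u, n v). *)
Definition coprime_quad_sum k l := \sum_(1 <= m < k.+1) \sum_(1 <= u < (k %/ m).+1)
  \sum_(1 <= v < u | coprime u v)
    sign_count k l (m * v) * \sum_(1 <= n < (k %/ v).+1) sign_count k l (n * u).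

(** Since u and v are coprime, u c = v y means c = n v and y = n u. The values n u > 3 k excluded on
    the left have [sign_count] 0 because l <= 2 k. *)
Lemma sum_proportional_pairs k l m u v : l <= 2 * k -> 0 < m -> 0 < v -> v < u -> coprime u v ->
  \sum_(1 <= c < k.+1) \sum_(1 <= y < (3 * k).+1)
     ((m * u) * c == (m * v) * y) * sign_count k l y =
  \sum_(1 <= n < (k %/ v).+1) sign_count k l (n * u).
Proof.
move=> lk m0 v0 vu cuv.
transitivity (\sum_(1 <= c < k.+1 | v %| c) \sum_(1 <= y < (3 * k).+1)
   (u * c == v * y) * sign_count k l y).
  rewrite [RHS]big_mkcond/=; apply: eq_bigr => c _.
  under eq_bigr => y _ do rewrite -!mulnA eqn_pmul2l//.
  case: ifPn => // nvc; rewrite big1// => y _.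
  case: eqP => // e; case/negP: nvc.
  by rewrite -(@Gauss_dvdr _ u) 1?coprime_sym// e dvdn_mulr.
rewrite sum_multiples//; apply: eq_big_nat => n /andP[n0 nk].
under eq_bigr => y _ do rewrite mulnCA eqn_pmul2l//.
have [le|gt] := leqP (u * n) (3 * k).
  have un0 : 0 < u * n by rewrite muln_gt0 n0 andbT (leq_ltn_trans _ vu).
  rewrite (big_rem (u * n))/=; last by rewrite mem_index_iota; lia.
  rewrite eqxx mul1n big1_seq ?addn0; first by rewrite mulnC.
  move=> y.
  rewrite rem_filter ?iota_uniq// mem_filter/= => /andP[ne _].
  by rewrite eq_sym (negbTE ne).
rewrite big1_seq.
  rewrite [u * n]mulnC in gt.
  have h1 : (n * u + l <= k) = false by lia.
  have h2 : (n * u <= l + k) = false by lia.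
  by rewrite /sign_count h1 h2 andbF.
move=> y; rewrite mem_index_iota => /andP[_ /andP[y0 yk]].
by case: eqP => // e; move: gt; rewrite e; lia.
Qed.

Lemma quad_sum_lt k l : l <= 2 * k ->
  \sum_(1 <= b < k.+1) \sum_(1 <= x < (3 * k).+1 | x < b)
    \sum_(1 <= c < k.+1) \sum_(1 <= y < (3 * k).+1) quad_weight k l b x c y = coprime_quad_sum k l.
Proof.
move=> lk.
pose G b x := sign_count k l x * \sum_(1 <= c < k.+1) \sum_(1 <= y < (3 * k).+1)
     (b * c == x * y) * sign_count k l y.
transitivity (\sum_(1 <= b < k.+1) \sum_(1 <= x < b) G b x).
  apply: eq_big_nat => b /andP[b0 bk].
  rewrite (@big_cat_nat _ _ _ b) ?addn1//=; last by lia.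
  rewrite [X in _ + X]big1_seq ?addn0; last first.
    by move=> x; rewrite mem_index_iota => /andP[xb /andP[bx _]]; lia.
  rewrite big_mkcond/=; apply: eq_big_nat => x /andP[x0 xb]; rewrite xb.
  rewrite /G big_distrr/=; apply: eq_bigr => c _.
  rewrite big_distrr/=; apply: eq_bigr => y _.
  by rewrite /quad_weight mulnCA.
rewrite (sum_by_gcd k G).
apply: eq_big_nat => m /andP[m0 _]; apply: eq_big_nat => u _.
rewrite big_mkcond [RHS]big_mkcond/=; apply: eq_big_nat => v /andP[v0 vu].
by case: ifPn => // c; rewrite /G sum_proportional_pairs.
Qed.

(** When bc = xy, b < x is equivalent to y < c, so exchanging (b, x) with (c, y) carries the part b
    < x onto the part x < b. On the diagonal x = b also y = c, which leaves at most k^2 solutions of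
    weight at most 4. *)
Lemma quad_sum_split k l : l <= 2 * k ->
  2 * coprime_quad_sum k l <= quad_sum k l <= 2 * coprime_quad_sum k l + 4 * k ^ 2.
Proof.
move=> lk.
have gt : \sum_(1 <= b < k.+1) \sum_(1 <= x < (3 * k).+1 | b < x)
    \sum_(1 <= c < k.+1) \sum_(1 <= y < (3 * k).+1) quad_weight k l b x c y = coprime_quad_sum k l.
  rewrite -quad_sum_lt//.
  transitivity (\sum_(1 <= b < k.+1) \sum_(1 <= x < (3 * k).+1)
    \sum_(1 <= c < k.+1) \sum_(1 <= y < (3 * k).+1) ((y < c) * quad_weight k l b x c y)).
    apply: eq_big_nat => b /andP[b0 _]; rewrite big_mkcond/=.
    apply: eq_big_nat => x /andP[x0 _].
    transitivity ((b < x) *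
      \sum_(1 <= c < k.+1) \sum_(1 <= y < (3 * k).+1) quad_weight k l b x c y).
      by case: ifP => _; rewrite ?mul1n ?mul0n.
    rewrite big_distrr/=; apply: eq_big_nat => c /andP[c0 _].
    rewrite big_distrr/=; apply: eq_big_nat => y /andP[y0 _].
    rewrite /quad_weight; case: eqP => [e|]; last by rewrite !mul0n !muln0.
    rewrite !mul1n; congr (nat_of_bool _ * _).
    by apply/idP/idP; nia.
  under eq_bigr do rewrite exchange_big/=.
  rewrite exchange_big/=.
  under eq_bigr do under eq_bigr do rewrite exchange_big/=.
  under eq_bigr do rewrite exchange_big/=.
  apply: eq_big_nat => b /andP[b0 _]; rewrite [RHS]big_mkcond/=.
  apply: eq_big_nat => x /andP[x0 xk].
  transitivity ((x < b) * \sum_(1 <= c < k.+1) \sum_(1 <= y < (3 * k).+1) quad_weight k l b x c y).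
    rewrite big_distrr/=; apply: eq_bigr => c _.
    rewrite big_distrr/=; apply: eq_bigr => y _.
    by rewrite /quad_weight [c * b]mulnC [y * x]mulnC [sign_count k l y * _]mulnC.
  by case: ifP => _; rewrite ?mul1n ?mul0n.
have eqd : \sum_(1 <= b < k.+1) \sum_(1 <= x < (3 * k).+1 | x == b)
    \sum_(1 <= c < k.+1) \sum_(1 <= y < (3 * k).+1) quad_weight k l b x c y <= 4 * k ^ 2.
  have -> : 4 * k ^ 2 = \sum_(1 <= b < k.+1) \sum_(1 <= c < k.+1) 4.
    by rewrite !sum_nat_const_nat !subn1/=; lia.
  rewrite !big_seq; apply: leq_sum => b; rewrite mem_index_iota => /andP[b0 bk].
  rewrite (big_rem b)/=; last by rewrite mem_index_iota; lia.
  rewrite eqxx [X in _ + X]big1_seq ?addn0; last first.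
    by move=> x /andP[/eqP ->]; rewrite rem_filter ?iota_uniq// mem_filter/= eqxx.
  rewrite !big_seq; apply: leq_sum => c; rewrite mem_index_iota => /andP[c0 ck].
  rewrite (big_rem c)/=; last by rewrite mem_index_iota; lia.
  rewrite [X in _ + X]big1_seq ?addn0; last first.
    move=> y; rewrite rem_filter ?iota_uniq// mem_filter/= => /andP[ne _].
    by rewrite /quad_weight eqn_pmul2l// eq_sym (negbTE ne).
  by rewrite /quad_weight eqxx mul1n (leq_mul (sign_count_le2 _ _ _) (sign_count_le2 _ _ _)).
have -> : quad_sum k l = coprime_quad_sum k l + coprime_quad_sum k l +
  \sum_(1 <= b < k.+1) \sum_(1 <= x < (3 * k).+1 | x == b)
    \sum_(1 <= c < k.+1) \sum_(1 <= y < (3 * k).+1) quad_weight k l b x c y.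
  rewrite -{1}quad_sum_lt// -gt -!big_split/=; apply: eq_bigr => b _.
  rewrite [X in _ = X + _ + _]big_mkcond [X in _ = _ + X + _]big_mkcond.
  rewrite [X in _ = _ + _ + X]big_mkcond -!big_split/=; apply: eq_bigr => x _.
  by case: (ltngtP x b); rewrite ?addn0 ?add0n.
by move: eqd; lia.
Qed.

End NatSums.

(** * Areas under nonincreasing functions *)

Section Area.
Variable R : realType.
Implicit Types (g : R -> R) (a b c d h l r x y V W : R).

Definition nonincr_on a b g := forall x y, a <= x -> x <= y -> y <= b -> g y <= g x.

(* An integral without integration theory: for a nonincreasing [g], the sandwich
   makes [P] an antiderivative and yields the comparison with Riemann sums. *)
Definition has_area g a b V := exists2 P : R -> R,
  (forall x y, a <= x -> x <= y -> y <= b ->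
     g y * (y - x) <= P y - P x <= g x * (y - x)) & P b - P a = V.

(** For x < b < y the two sandwiches are added at b, where monotonicity gives g y <= g b <= g x. *)
Lemma has_area_cat g a b c V W : a <= b -> b <= c -> nonincr_on a c g ->
  has_area g a b V -> has_area g b c W -> has_area g a c (V + W).
Proof.
move=> ab bc mg [P HP VP] [Q HQ WQ].
pose S x := if x <= b then P x - P b else Q x - Q b.
have Sb : S b = 0 by rewrite /S lexx subrr.
have Sge x : b <= x -> S x = Q x - Q b.
  by rewrite /S; case: (ltgtP x b) => // ->; rewrite !subrr.
have Sle x : x <= b -> S x = P x - P b by rewrite /S => ->.
exists S; last by rewrite Sge// Sle// -VP -WQ; lra.
move=> x y ax xy yc.
have [yb|/ltW by_] := leP y b.
  have xb := le_trans xy yb.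
  by rewrite !Sle//; have := HP x y ax xy yb; lra.
have [xb|/ltW bx] := leP x b; last first.
  by rewrite !Sge//; have := HQ x y bx xy yc; lra.
rewrite (Sge y)// (Sle x)//.
have /andP[p1 p2] := HP x b ax xb (lexx _).
have /andP[q1 q2] := HQ b y (lexx _) by_ yc.
have g1 : g b <= g x by apply: mg.
have g2 : g y <= g b by apply: mg.
have : 0 <= b - x by rewrite subr_ge0.
have : 0 <= y - b by rewrite subr_ge0.
move=> h1 h2; apply/andP; split.
  have : g y * (b - x) <= g b * (b - x) by rewrite ler_wpM2r.
  by lra.
have : g b * (y - b) <= g x * (y - b) by rewrite ler_wpM2r.
by lra.
Qed.

(* The area is given by Simpson's rule, which is exact in this degree. *)
Lemma has_area_quadratic g a b p q r : a <= b -> nonincr_on a b g ->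
  (forall x, a <= x <= b -> g x = p * x ^+ 2 + q * x + r) ->
  has_area g a b ((b - a) * (g a + 4 * g ((a + b) / 2) + g b) / 6).
Proof.
move=> ab mg Hg.
pose P x : R := p * x ^+ 3 / 3 + q * x ^+ 2 / 2 + r * x.
have simpson x y : a <= x -> x <= y -> y <= b ->
    P y - P x = (y - x) * (g x + 4 * g ((x + y) / 2) + g y) / 6.
  move=> ax xy yb; have H z : x <= z -> z <= y -> a <= z <= b by move=> *; apply/andP; split; lra.
  by rewrite !Hg ?H//; [rewrite /P; field|lra..].
exists P; last by rewrite simpson.
move=> x y ax xy yb; rewrite simpson//.
have g1 : g ((x + y) / 2) <= g x by apply: mg; lra.
have g2 : g y <= g ((x + y) / 2) by apply: mg; lra.
have d : 0 <= y - x by rewrite subr_ge0.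
have h1 := ler_wpM2r d g1; have h2 := ler_wpM2r d g2.
by apply/andP; split; lra.
Qed.

Lemma has_area_riemann g V h (N : nat) : 0 <= h -> has_area g 0 (N%:R * h) V ->
  h * \sum_(1 <= i < N.+1) g (i%:R * h) <= V <= h * \sum_(0 <= i < N) g (i%:R * h).
Proof.
move=> h0 [P HP <-].
have -> : P (N%:R * h) - P 0 = \sum_(0 <= i < N) (P (i.+1%:R * h) - P (i%:R * h)).
  by rewrite (telescope_sumr (fun i => P (i%:R * h)) (leq0n N)); congr (_ - P _); rewrite mul0r.
have HPi i : (i < N)%N -> g (i.+1%:R * h) * h <= P (i.+1%:R * h) - P (i%:R * h)
      <= g (i%:R * h) * h.
  move=> iN; have e : i.+1%:R * h - i%:R * h = h by rewrite -natr1; ring.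
  have := HP (i%:R * h) (i.+1%:R * h); rewrite e; apply.
  - by rewrite mulr_ge0.
  - by rewrite ler_wpM2r// ler_nat.
  - by rewrite ler_wpM2r// ler_nat.
rewrite big_add1/= !mulr_sumr; apply/andP; split; apply: ler_sum_nat => i /andP[_ iN];
  by have /andP[? ?] := HPi i iN; rewrite [h * _]mulrC.
Qed.

Lemma max0_l x : x <= 0 -> Num.max 0 x = 0.
Proof. exact: max_l. Qed.

Lemma max0_r x : 0 <= x -> Num.max 0 x = x.
Proof. exact: max_r. Qed.

Lemma min1_l x : 1 <= x -> Num.min 1 x = 1.
Proof. exact: min_l. Qed.

Lemma min1_r x : x <= 1 -> Num.min 1 x = x.
Proof. exact: min_r. Qed.

(* For [0 <= l] and [0 < r < 1], the length of {s | |s| <= 1 and |s r + l| <= 1};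
   for [0 <= l <= 2], [len2 l r] is that of {t | |t r| <= 1 and |t + l| <= 1}. *)
Definition len1 (l r : R) :=
  1 - Num.min 1 (Num.max 0 (l - 1) / r) + Num.min 1 (Num.max 0 (1 - l) / r).
Definition len2 (l r : R) := Num.min r^-1 (1 + l) + 1 - l.
Definition len12 r l := len1 l r * len2 l r.
(* The integral of [len12 r] over [0, 2] for 0 < r < 1; moreover [J 0 = 4], the
   right value, since the numerator of the junk fraction is 0. *)
Definition J (r : R) := 4 - Num.max 0 (r ^+ 2 + 2 * r - 1) ^+ 3 / (6 * r ^+ 4).

Lemma len1_nonincr r l l' : 0 < r -> l <= l' -> len1 l' r <= len1 l r.
Proof.
move=> r0 ll; rewrite /len1; apply: lerD.
  rewrite lerD2l lerN2 le_min2// ler_wpM2r ?invr_ge0 ?(ltW r0)//.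
  by rewrite le_max2// lerD2r.
by rewrite le_min2// ler_wpM2r ?invr_ge0 ?(ltW r0)// le_max2// lerD2l lerN2.
Qed.

Lemma len1_ge0 r l : 0 < r -> 0 <= len1 l r.
Proof.
move=> r0.
rewrite /len1 addr_ge0// ?subr_ge0 ?ge_min ?lexx// le_min ler01/=.
by rewrite divr_ge0 ?(ltW r0)// le_max lexx.
Qed.

Lemma len1_le2 r l : 0 < r -> len1 l r <= 2.
Proof.
move=> r0.
have : 0 <= Num.min 1 (Num.max 0 (l - 1) / r).
  by rewrite le_min ler01 divr_ge0 ?(ltW r0)// le_max lexx.
have : Num.min 1 (Num.max 0 (1 - l) / r) <= 1 by rewrite ge_min lexx.
by rewrite /len1; lra.
Qed.

Lemma len1_lo r l : 0 < r -> l <= 1 - r -> len1 l r = 2.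
Proof.
move=> r0 h; rewrite /len1 (@max0_l (l - 1)); last by lra.
rewrite mul0r (min1_r ler01) (@max0_r (1 - l)); last by lra.
by rewrite min1_l ?subr0// ler_pdivlMr//; lra.
Qed.

Lemma len1_mid r l : 0 < r -> 1 - r <= l -> l <= 1 + r -> len1 l r = 1 + (1 - l) / r.
Proof.
move=> r0 h1 h2; rewrite /len1.
case: (lerP l 1) => h.
  rewrite (@max0_l (l - 1)); last by lra.
  rewrite mul0r (min1_r ler01) (@max0_r (1 - l)); last by lra.
  by rewrite min1_r ?subr0// ler_pdivrMr//; lra.
rewrite (@max0_r (l - 1)); last by lra.
rewrite (@max0_l (1 - l)); last by lra.
rewrite mul0r (min1_r ler01) min1_r; first by field; rewrite gt_eqF.
by rewrite ler_pdivrMr//; lra.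
Qed.

Lemma len1_hi r l : 0 < r -> 1 + r <= l -> len1 l r = 0.
Proof.
move=> r0 h; rewrite /len1 (@max0_r (l - 1)); last by lra.
rewrite (@max0_l (1 - l)); last by lra.
rewrite mul0r (min1_r ler01) min1_l; first by lra.
by rewrite ler_pdivlMr//; lra.
Qed.

Lemma len2_nonincr r l l' : l <= l' -> len2 l' r <= len2 l r.
Proof.
move=> ll; rewrite /len2 /Num.min; case: ifPn; case: ifPn; rewrite -?leNgt; lra.
Qed.

Lemma len2_ge0 r l : 0 < r -> r < 1 -> l <= 2 -> 0 <= len2 l r.
Proof.
move=> r0 r1 ll; have : 1 < r^-1 by rewrite invf_gt1.
by rewrite /len2 /Num.min; case: ifPn => ?; lra.
Qed.

Lemma len2_le2 r l : len2 l r <= 2.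
Proof.
have : Num.min r^-1 (1 + l) <= 1 + l by rewrite ge_min lexx orbT.
by rewrite /len2; lra.
Qed.

Lemma len12_nonincr r : 0 < r -> r < 1 -> nonincr_on 0 2 (len12 r).
Proof.
move=> r0 r1 x y x0 xy y2; rewrite /len12 ler_pM ?len1_ge0 ?len2_ge0//.
  exact: len1_nonincr.
exact: len2_nonincr.
Qed.

Lemma len12_bounds r l : 0 < r -> r < 1 -> l <= 2 -> 0 <= len12 r l <= 4.
Proof.
move=> r0 r1 l2; rewrite /len12 mulr_ge0 ?len1_ge0 ?len2_ge0//=.
have -> : 4 = 2 * 2 :> R by ring.
by rewrite ler_pM ?len1_ge0 ?len2_ge0 ?len1_le2 ?len2_le2.
Qed.

Lemma nonincr_sub g a b c d : c <= a -> b <= d -> nonincr_on c d g -> nonincr_on a b g.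
Proof. by move=> ca bd m x y ax xy yb; apply: m => //; lra. Qed.

Lemma len2_lo r l : 1 + l <= r^-1 -> len2 l r = 2.
Proof. by move=> h; rewrite /len2 min_r//; ring. Qed.

Lemma len2_hi r l : r^-1 <= 1 + l -> len2 l r = r^-1 + 1 - l.
Proof. by move=> h; rewrite /len2 min_l. Qed.

(** Trades Simpson's values for the exact integral of the quadratic, so that a candidate V is
    checked by algebra alone. *)
Lemma has_area_len12_piece r a b p q s V : 0 < r -> r < 1 -> 0 <= a -> a <= b -> b <= 2 ->
  (forall x, a <= x -> x <= b -> len12 r x = p * x ^+ 2 + q * x + s) ->
  V = (b - a) * (p * (a ^+ 2 + a * b + b ^+ 2) / 3 + q * (a + b) / 2 + s) ->
  has_area (len12 r) a b V.
Proof.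
move=> r0 r1 a0 ab b2 Hf ->.
have -> : (b - a) * (p * (a ^+ 2 + a * b + b ^+ 2) / 3 + q * (a + b) / 2 + s) =
    (b - a) * (len12 r a + 4 * len12 r ((a + b) / 2) + len12 r b) / 6.
  by rewrite !Hf; [field|lra..].
apply: (@has_area_quadratic _ _ _ p q s) => //.
  by apply: (nonincr_sub a0 b2); apply: len12_nonincr.
by move=> x /andP[ax xb]; rewrite Hf.
Qed.

(* [len12 r] changes its expression at 1 - r, at 1/r - 1 (if this is < 1 + r) and at 1 + r. *)
Lemma has_area_len12 r : 0 < r -> r < 1 -> has_area (len12 r) 0 2 (J r).
Proof.
move=> r0 r1.
have rr : r * r^-1 = 1 by rewrite divff// gt_eqF.
(* This is (1 - r)^2 >= 0; it places the break point 1/r - 1 not before 1 - r. *)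
have ri2 : 2 - r <= r^-1.
  by rewrite -[leRHS]mul1r ler_pdivlMr//; nra.
have mono := len12_nonincr r0 r1.
have A1 : has_area (len12 r) 0 (1 - r) (4 * (1 - r)).
  apply: (@has_area_len12_piece _ _ _ 0 0 4) => //; try lra.
  move=> x x0 xr; rewrite /len12 len1_lo// len2_lo; first by ring.
  by lra.
have A3 : has_area (len12 r) (1 + r) 2 0.
  apply: (@has_area_len12_piece _ _ _ 0 0 0) => //; try lra.
  by move=> x x0 xr; rewrite /len12 len1_hi// mul0r; ring.
suff [V A2 EV] : exists2 V, has_area (len12 r) (1 - r) (1 + r) V & 4 * (1 - r) + V = J r.
  have A23 : has_area (len12 r) (1 - r) 2 (V + 0).
    apply: (has_area_cat _ _ _ A2 A3); [lra|lra|].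
    by apply: (@nonincr_sub _ _ _ 0 2) => //; lra.
  have := has_area_cat _ _ mono A1 A23.
  by rewrite addr0 EV; apply; lra.
(* The polynomial in [J] is positive exactly when 1/r - 1 < 1 + r; otherwise [len2] keeps the value
   2 up to 1 + r. *)
case: (lerP (r ^+ 2 + 2 * r - 1) 0) => h.
  have si : 2 + r <= r^-1 by rewrite -[leRHS]mul1r ler_pdivlMr//; nra.
  exists (4 * r); last by rewrite /J max0_l//; field; rewrite gt_eqF.
  apply: (@has_area_len12_piece _ _ _ 0 (- 2 / r) (2 + 2 / r)) => //; try lra.
    move=> x h1 h2; rewrite /len12 len1_mid// len2_lo; last by lra.
    by ring.
have s1 : r^-1 <= 2 + r by rewrite -[leLHS]mul1r ler_pdivrMr//; nra.
pose s := r^-1 - 1.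
pose V1 := (s - (1 - r)) * (- 2 / r * ((1 - r) + s) / 2 + (2 + 2 / r)).
pose q := - (r^-1 * (r^-1 + 1) + (1 + r^-1)).
pose V2 := (1 + r - s) * (r^-1 * (s ^+ 2 + s * (1 + r) + (1 + r) ^+ 2) / 3 +
   q * (s + (1 + r)) / 2 + (1 + r^-1) * (r^-1 + 1)).
exists (V1 + V2); last first.
  by rewrite /J max0_r ?(ltW h)// /V1 /V2 /q /s; field; rewrite gt_eqF.
apply: (@has_area_cat _ _ s).
- by rewrite /s; lra.
- by rewrite /s; lra.
- by apply: (@nonincr_sub _ _ _ 0 2) => //; lra.
- apply: (@has_area_len12_piece _ _ _ 0 (- 2 / r) (2 + 2 / r)) => //.
  + by lra.
  + by rewrite /s; lra.
  + by rewrite /s; lra.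
  + rewrite /s => x h1 h2; rewrite /len12 len1_mid//; last by lra.
    rewrite len2_lo; last by lra.
    by ring.
  + by rewrite /V1; ring.
- apply: (@has_area_len12_piece _ _ _ r^-1 q ((1 + r^-1) * (r^-1 + 1))) => //.
  + by rewrite /s; lra.
  + by rewrite /s; lra.
  + by lra.
  + rewrite /s /q => x h1 h2; rewrite /len12 len1_mid//; last by lra.
    rewrite len2_hi; last by lra.
    by ring.
Qed.

End Area.

(** * The Basel problem *)

Section Basel.
Variable R : realType.
Implicit Types x : R.

Lemma sin_le_id x : 0 <= x -> sin x <= x.
Proof.
move=> x0; have [|c _] := @MVT_segment _ sin cos 0 x x0.
  exact/continuous_subspaceT/continuous_sin.
rewrite sin0 !subr0 => ->; rewrite -[leRHS]mul1r.
by rewrite ler_wpM2r// cos_le1.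
Qed.

Lemma cos_le_sin x : 0 <= x <= pi / 2 -> x * cos x <= sin x.
Proof.
move=> /andP[x0 xpi].
pose h (y : R) := sin y - y * cos y.
have dh (y : R) : is_derive y 1 h (y * sin y).
  by apply: is_derive_eq; rewrite /GRing.scale/=; ring.
have [|c /itvP cx] := @MVT_segment _ h (fun y => y * sin y) 0 x x0 (fun y _ => dh y).
  by apply: derivable_within_continuous => y _; apply: ex_derive.
rewrite /h sin0 mul0r !subr0 -subr_ge0 => ->; rewrite mulr_ge0// mulr_ge0 ?cx//.
apply: sin_ge0_pi; rewrite cx/= (le_trans _ (_ : x <= pi))// ?cx//.
by have := pi_ge0 R; lra.
Qed.

(** From x cos x <= sin x <= x, through 1/sin^2 = cot^2 + 1. *)
Lemma inv_sin_sqr x : 0 < x < pi / 2 ->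
  (x ^+ 2)^-1 <= (sin x ^+ 2)^-1 <= (x ^+ 2)^-1 + 1.
Proof.
move=> /andP[x0 xpi].
have s0 : 0 < sin x by apply: sin_gt0_pihalf; rewrite x0.
have c0 : 0 <= cos x.
  by apply: cos_ge0_pihalf; have := pi_gt0 R; move: x0 xpi; lra.
have s1 := sin_le_id (ltW x0).
have s2 : x * cos x <= sin x by apply: cos_le_sin; rewrite !ltW.
apply/andP; split.
  by rewrite lef_pV2 ?posrE ?exprn_gt0// lerXn2r ?nnegrE// ltW.
have -> : (sin x ^+ 2)^-1 = (cos x / sin x) ^+ 2 + 1.
  by rewrite expr_div_n cos2sin2; field; rewrite gt_eqF.
rewrite lerD2r -exprVn lerXn2r ?nnegrE ?divr_ge0 ?invr_ge0 ?(ltW s0) ?(ltW x0)//.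
by rewrite ler_pdivrMr// mulrC ler_pdivlMr// mulrC.
Qed.

Let ang n j : R := (2 * j + 1)%:R * pi / (2 ^ (n + 2))%:R.

Lemma ang_bounds n j : (j < 2 ^ n)%N -> 0 < ang n j < pi / 2.
Proof.
move=> jn; have pp : 0 < (2 ^ (n + 2))%:R :> R by rewrite ltr0n expn_gt0.
have h : ((2 * j + 1)%:R : R) * 2 < (2 ^ (n + 2))%:R.
  by rewrite -natrM ltr_nat addn2 !expnS; lia.
apply/andP; split.
  by rewrite divr_gt0// mulr_gt0 ?pi_gt0// ltr0n addn1.
rewrite /ang ltr_pdivrMr// [ltLHS]mulrC -mulrA ltr_pM2l ?pi_gt0//.
by move: h; lra.
Qed.

(* The angles of level n + 1 are the halves of those of level n and their complements to pi / 2. *)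
Lemma sum_inv_sin_sqr n :
  \sum_(0 <= j < 2 ^ n) (sin (ang n j) ^+ 2)^-1 = 2 * 4 ^+ n.
Proof.
elim: n => [|n IH].
  rewrite big_nat1 /ang mul1r expr0 mulr1.
  have : cos (pi / 4 *+ 2) = 0 :> R.
    by rewrite -[RHS]cos_pihalf; congr cos; field.
  rewrite cos_mulr2n => h.
  have -> : sin (pi / 4 : R) ^+ 2 = 2^-1 by rewrite sin2cos2; lra.
  by rewrite invrK.
have posN : (2 ^ n < 2 ^ n.+1)%N by rewrite ltn_exp2l.
rewrite (@big_cat_nat _ _ _ (2 ^ n))//=; last exact: ltnW.
have shift (F : nat -> R) :
    \sum_(2 ^ n <= i < 2 ^ n.+1) F i = \sum_(0 <= j < 2 ^ n) F (j + 2 ^ n)%N.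
  rewrite -{1}[(2 ^ n)%N]add0n big_addn.
  by have -> : (2 ^ n.+1 - 2 ^ n = 2 ^ n)%N by rewrite expnS; lia.
(* Reversing the upper half pairs each angle of the lower half with its complement to pi / 2, on
   which the sine becomes the cosine. *)
rewrite [X in _ + X]big_nat_rev/= shift.
rewrite -big_split/= exprS mulrCA -IH mulr_sumr.
apply: eq_big_nat => j /andP[_ jn].
have en : (2 ^ (n.+1 + 2))%:R = 2 * (2 ^ (n + 2))%:R :> R.
  by rewrite -natrM -expnS.
have p0 : (2 ^ (n + 2))%:R != 0 :> R by rewrite pnatr_eq0 expn_eq0.
have e1 : ang n j = ang n.+1 j *+ 2.
  by rewrite /ang en; field.
have e2 : sin (ang n.+1 (2 ^ n + 2 ^ n.+1 - (j + 2 ^ n).+1)%N) = cos (ang n.+1 j).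
  rewrite -[cos _]opprK -sinBpihalf -sinN; congr sin.
  have -> : (2 ^ n + 2 ^ n.+1 - (j + 2 ^ n).+1 = 2 ^ n.+1 - j.+1)%N by lia.
  rewrite /ang en.
  have -> : (2 * (2 ^ n.+1 - j.+1) + 1)%N%:R = (2 ^ (n + 2))%:R - (2 * j + 1)%:R :> R.
    rewrite -natrB; last by rewrite addn2 !expnS; lia.
    by congr _%:R; rewrite addn2 !expnS; lia.
  by field.
have in0 : 0 < ang n.+1 j < pi / 2 by apply: ang_bounds; rewrite (ltn_trans jn).
have s0 : sin (ang n.+1 j) != 0 by rewrite gt_eqF// sin_gt0_pihalf.
have c0 : cos (ang n.+1 j) != 0.
  by rewrite gt_eqF// cos_gt0_pihalf//; case/andP: in0; have := pi_gt0 R; lra.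
rewrite e2 e1 sin_mulr2n.
have := cos2Dsin2 (ang n.+1 j).
set s := sin _ in s0 *; set c := cos _ in c0 * => h.
transitivity ((c ^+ 2 + s ^+ 2) / (s ^+ 2 * c ^+ 2)); first by field; rewrite s0 c0.
by rewrite h; field; rewrite s0 c0.
Qed.

(** Replacing each 1/sin^2 by the inverse square of its angle loses at most 1 per term, that is 2^n
    in all, against the exact total 2 * 4^n. The inverse squares of the angles are those of the odd
    integers scaled by 16 * 4^n / pi^2. *)
Lemma odd_basel n :
  pi ^+ 2 / 8 * (1 - (2 ^+ n)^-1 / 2) <=
  \sum_(0 <= j < 2 ^ n) (((2 * j + 1)%:R : R) ^+ 2)^-1 <= pi ^+ 2 / 8.
Proof.
have p0 := pi_gt0 R.
have q0 : 0 < 2 ^+ n :> R by rewrite exprn_gt0.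
have sc : \sum_(0 <= j < 2 ^ n) (ang n j ^+ 2)^-1 =
   16 * (2 ^+ n) ^+ 2 / pi ^+ 2 * \sum_(0 <= j < 2 ^ n) (((2 * j + 1)%:R : R) ^+ 2)^-1.
  rewrite mulr_sumr; apply: eq_bigr => j _; rewrite /ang natrX exprD.
  have : (2 * j + 1)%:R != 0 :> R by rewrite pnatr_eq0 addn1.
  move: (2 * j + 1)%:R (2 ^+ n) q0 (pi) p0 => a b b0 p p0 a0.
  by field; rewrite a0 !gt_eqF.
have four : 4 ^+ n = (2 ^+ n) ^+ 2 :> R.
  by rewrite exprAC; congr (_ ^+ _); ring.
have up : \sum_(0 <= j < 2 ^ n) (ang n j ^+ 2)^-1 <= 2 * 4 ^+ n.
  rewrite -sum_inv_sin_sqr; apply: ler_sum_nat => j /andP[_ jn].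
  by case/andP: (inv_sin_sqr (ang_bounds jn)).
have lo : 2 * 4 ^+ n <= \sum_(0 <= j < 2 ^ n) (ang n j ^+ 2)^-1 + 2 ^+ n.
  have -> : 2 ^+ n = \sum_(0 <= j < 2 ^ n) (1 : R).
    by rewrite sumr_const_nat subn0 natrX.
  rewrite -big_split/= -sum_inv_sin_sqr; apply: ler_sum_nat => j /andP[_ jn].
  by case/andP: (inv_sin_sqr (ang_bounds jn)).
move: up lo; rewrite sc four; set O := \sum_(_ <= _ < _) _; set q := 2 ^+ n in q0 *.
move=> up lo; set c := 16 * q ^+ 2 / pi ^+ 2 in up lo.
have c0 : 0 < c by rewrite /c divr_gt0 ?mulr_gt0 ?exprn_gt0.
apply/andP; split; rewrite -(ler_pM2l c0).
  apply: le_trans (_ : 2 * q ^+ 2 - q <= _); last by lra.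
  rewrite le_eqVlt; apply/orP; left; apply/eqP; rewrite /c.
  by move: (pi) p0 => p p0; field; rewrite !gt_eqF.
apply: (le_trans up).
rewrite le_eqVlt; apply/orP; left; apply/eqP; rewrite /c.
by move: (pi) p0 => p p0; field; rewrite !gt_eqF.
Qed.

Definition inv_sqr_sum n : R := \sum_(1 <= g < n.+1) ((g%:R : R) ^+ 2)^-1.

Lemma inv_sqr_sumS n : inv_sqr_sum n.+1 = inv_sqr_sum n + ((n.+1%:R : R) ^+ 2)^-1.
Proof. by rewrite /inv_sqr_sum big_nat_recr. Qed.

(** Splitting by parity links the full sum to the odd squares evaluated in [odd_basel]. *)
Lemma inv_sqr_sum_double n : inv_sqr_sum (2 * n) =
  \sum_(0 <= j < n) (((2 * j + 1)%:R : R) ^+ 2)^-1 + inv_sqr_sum n / 4.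
Proof.
elim: n => [|n IH]; first by rewrite /inv_sqr_sum !big_nil mul0r addr0.
have -> : (2 * n.+1 = (2 * n).+2)%N by lia.
rewrite !inv_sqr_sumS IH big_nat_recr//=.
have -> : ((2 * n).+2%:R : R) = 2 * n.+1%:R by rewrite -natrM; congr _%:R; lia.
rewrite addn1.
have : (2 * n).+1%:R != 0 :> R by rewrite pnatr_eq0.
have : n.+1%:R != 0 :> R by rewrite pnatr_eq0.
by move: (2 * n).+1%:R n.+1%:R => a b a0 b0; field; rewrite a0 b0.
Qed.

Lemma le0_of_le_pow2 (x K : R) : (forall n : nat, x <= K / 2 ^+ n) -> x <= 0.
Proof.
move=> h; rewrite leNgt; apply/negP => x0.
have K0 : 0 < K by have := h 0%N; rewrite expr0 divr1; apply: lt_le_trans.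
pose n := Num.bound (K / x).
have : K / x < n%:R by rewrite /n archi_boundP// divr_ge0 ?ltW.
have := h n; rewrite ler_pdivlMr ?exprn_gt0// => h1.
rewrite ltr_pdivrMr// => h2.
have : n%:R <= 2 ^+ n :> R by rewrite -natrX ler_nat ltnW// ltn_expl.
by nra.
Qed.

(** The upper bound holds because [inv_sqr_sum m] + 1/m is nonincreasing in m, as 1/(m + 1)^2 <= 1/m
    - 1/(m + 1). *)
Lemma inv_sqr_sum_le m n : (0 < n)%N -> (n <= m)%N ->
  inv_sqr_sum n <= inv_sqr_sum m <= inv_sqr_sum n + n%:R^-1.
Proof.
move=> n0 nm.
suff : inv_sqr_sum n <= inv_sqr_sum m /\
       inv_sqr_sum m + m%:R^-1 <= inv_sqr_sum n + n%:R^-1.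
  move=> [-> h]; apply: le_trans h; by rewrite lerDl invr_ge0.
elim: m nm => [|m IH]; first by lia.
rewrite leq_eqVlt => /predU1P[<-//|]; rewrite ltnS => nm.
have [h1 h2] := IH nm.
have m0 : 0 < m%:R :> R by rewrite ltr0n (leq_trans n0).
rewrite inv_sqr_sumS.
split; first by rewrite (le_trans h1)// lerDl invr_ge0 exprn_ge0.
apply: le_trans h2; rewrite -addrA lerD2l -natr1.
rewrite -subr_ge0.
have -> : m%:R^-1 - (((m%:R + 1) ^+ 2)^-1 + (m%:R + 1)^-1) =
  (m%:R * (m%:R + 1) ^+ 2)^-1 :> R.
  by field; rewrite !gt_eqF// addr_gt0.
by rewrite invr_ge0 mulr_ge0 ?exprn_ge0 ?addr_ge0 ?ltW.
Qed.

Lemma inv_sqr_sum_bounds n : (0 < n)%N ->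
  inv_sqr_sum n <= pi ^+ 2 / 6 <= inv_sqr_sum n + n%:R^-1.
Proof.
have [K HK] : exists K : R, forall p : nat,
    `|pi ^+ 2 / 6 - inv_sqr_sum (2 ^ p)| <= K / 2 ^+ p.
  (* The error at 2^(p+1) is a quarter of the error at 2^p plus that of [odd_basel], at most (pi^2 /
     16) / 2^p; so a bound K / 2^p propagates once K >= pi^2. *)
  exists (`|pi ^+ 2 / 6 - inv_sqr_sum 1| + pi ^+ 2).
  elim=> [|p IH]; first by rewrite expr0 divr1 expn0 lerDl sqr_ge0.
  have e : pi ^+ 2 / 6 - inv_sqr_sum (2 ^ p.+1) =
     (pi ^+ 2 / 8 - \sum_(0 <= j < 2 ^ p) (((2 * j + 1)%:R : R) ^+ 2)^-1) +
     (pi ^+ 2 / 6 - inv_sqr_sum (2 ^ p)) / 4.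
    by rewrite expnS inv_sqr_sum_double; field.
  have /andP[w1 w2] := odd_basel p.
  set K := _ + pi ^+ 2 in IH *.
  have pK : pi ^+ 2 <= K by rewrite lerDr.
  have q0 : 0 < (2 ^+ p)^-1 :> R by rewrite invr_gt0 exprn_gt0.
  move: IH; rewrite e !ler_norml (exprS 2 p) invfM => /andP[i1 i2].
  move: w1 w2 i1 i2 pK; set O := \sum_(_ <= _ < _) _.
  have := sqr_ge0 (pi : R).
  move: q0; set q := (2 ^+ p)^-1; set P := pi ^+ 2; set D := P / 6 - _.
  move=> q0 P0 w1 w2 i1 i2 pK.
  have := mulr_ge0 P0 (ltW q0); have : P * q <= K * q by rewrite ler_wpM2r// ltW.
  move=> h1 h2; apply/andP; split; lra.
have K0 : 0 <= K.
  by have := HK 0%N; rewrite expr0 divr1; apply: le_trans.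
(* No limit is taken: n is compared with 2^(p + n) >= n, and each bound holds up to K / 2^p for
   every p. *)
move=> n0; apply/andP; split; rewrite -subr_le0; apply: (@le0_of_le_pow2 _ K) => p.
- apply: le_trans (_ : inv_sqr_sum (2 ^ (p + n)) - pi ^+ 2 / 6 <= _).
    rewrite lerD2r; have := @inv_sqr_sum_le (2 ^ (p + n)) n n0.
    rewrite (leq_trans (ltnW (ltn_expl n (ltnSn 1))))// ?leq_exp2l ?leq_addl//.
    by move=> /(_ isT) /andP[].
  apply: le_trans (_ : K / 2 ^+ (p + n) <= _).
    by apply: le_trans (HK _); rewrite distrC ler_norm.
  by rewrite ler_wpM2l// lef_pV2 ?posrE ?exprn_gt0// ler_weXn2l ?leq_addr// ler1n.
- apply: le_trans (_ : pi ^+ 2 / 6 - inv_sqr_sum (2 ^ (p + n)) <= _).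
    rewrite lerD2l lerN2; have := @inv_sqr_sum_le (2 ^ (p + n)) n n0.
    rewrite (leq_trans (ltnW (ltn_expl n (ltnSn 1))))// ?leq_exp2l ?leq_addl//.
    by move=> /(_ isT) /andP[].
  apply: le_trans (_ : K / 2 ^+ (p + n) <= _).
    by apply: le_trans (HK _); rewrite ler_norm.
  by rewrite ler_wpM2l// lef_pV2 ?posrE ?exprn_gt0// ler_weXn2l ?leq_addr// ler1n.
Qed.

End Basel.

(** * The coprime sum of J *)

Section AreaJ.
Variable R : realType.
Implicit Types (g P : R -> R) (a b x y : R).

Lemma has_area_deriv g P a b : nonincr_on a b g ->
  (forall x, a <= x <= b -> is_derive x 1 P (g x)) -> has_area g a b (P b - P a).
Proof.
move=> mg dP; exists P => // x y ax xy yb.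
have inab z : z \in `[x, y] -> a <= z <= b.
  by rewrite in_itv/= => /andP[xz zy]; rewrite (le_trans ax)// (le_trans zy).
have [z zxy||z zxy ->] := @MVT_segment _ P g x y xy.
- by apply/dP/inab/subset_itv_oo_cc.
- apply: derivable_within_continuous => z zxy.
  by have /inab/dP := zxy => d; exact: ex_derive.
have := zxy; rewrite in_itv/= => /andP[xz zy].
have d : 0 <= y - x by rewrite subr_ge0.
by apply/andP; split; rewrite ler_wpM2r// mg// (le_trans ax, le_trans zy).
Qed.

(* With q r = r^2 + 2 r - 1, both q r / r and q r / r^2 are nondecreasing on ]0, 1]. *)
Lemma J_nonincr : nonincr_on 0 1 (@J R).
Proof.
move=> x y x0 xy y1; rewrite /J lerD2l lerN2.
have q0 z : 0 <= Num.max 0 (z ^+ 2 + 2 * z - 1) ^+ 3 / (6 * z ^+ 4) :> R.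
  by rewrite divr_ge0 ?exprn_ge0 ?le_max ?lexx// mulr_ge0// (@exprn_even_ge0 _ 4).
case: (lerP (x ^+ 2 + 2 * x - 1) 0) => qx.
  by rewrite expr0n mul0r.
have xp : 0 < x by nra.
have qxy : x ^+ 2 + 2 * x - 1 <= y ^+ 2 + 2 * y - 1 by nra.
have qy := lt_le_trans qx qxy.
rewrite max0_r ?(ltW qy)//.
have yp : 0 < y := lt_le_trans xp xy.
have h1 : (x ^+ 2 + 2 * x - 1) * y <= (y ^+ 2 + 2 * y - 1) * x.
  rewrite -subr_ge0 (_ : _ - _ = (y - x) * (x * y + 1)); last by ring.
  by rewrite mulr_ge0 ?subr_ge0// addr_ge0// mulr_ge0 ?ltW.
have h2 : (x ^+ 2 + 2 * x - 1) * y ^+ 2 <= (y ^+ 2 + 2 * y - 1) * x ^+ 2.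
  rewrite -subr_ge0 (_ : _ - _ = (y - x) * (x * (1 - y) + y * (1 - x))); last by ring.
  by rewrite mulr_ge0 ?subr_ge0// addr_ge0// mulr_ge0 ?subr_ge0// ?(ltW yp)// (le_trans xy).
rewrite ler_pdivrMr ?mulr_gt0 ?exprn_gt0// mulrAC ler_pdivlMr ?mulr_gt0 ?exprn_gt0//.
move: qx qy h1 h2; set p := _ - 1; set q := _ - 1 => qx qy h1 h2.
(* The quotient q^3 / r^4 is split as (q / r)^2 (q / r^2), a product of nonnegative nondecreasing
   factors. *)
have -> : p ^+ 3 * (6 * y ^+ 4) = 6 * ((p * y) * (p * y) * (p * y ^+ 2)) by ring.
have -> : q ^+ 3 * (6 * x ^+ 4) = 6 * ((q * x) * (q * x) * (q * x ^+ 2)) by ring.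
have p1 : 0 <= p * y by rewrite mulr_ge0 ?ltW.
have p2 : 0 <= p * y ^+ 2 by rewrite mulr_ge0 ?exprn_ge0 ?ltW.
apply: ler_wpM2l => //; apply: ler_pM => //; first by rewrite mulr_ge0.
exact: ler_pM.
Qed.

Lemma J_bounds x : 0 <= x <= 1 -> 0 <= J x <= 4.
Proof.
move=> /andP[x0 x1]; apply/andP; split.
  have : J 1 <= J x by apply: J_nonincr.
  apply: le_trans; rewrite /J max0_r; last by lra.
  by rewrite (_ : _ - _ = 8 / 3); [lra|field].
rewrite /J gerBl divr_ge0 ?exprn_ge0 ?le_max ?lexx//.
by rewrite mulr_ge0// exprn_ge0.
Qed.

Definition int_J : R := 2 / 9 * (4 + 7 * Num.sqrt 2 + 3 * ln (Num.sqrt 2 + 1)).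

Lemma has_area_J : has_area (@J R) 0 1 int_J.
Proof.
have := sqr_sqrtr (ler0n R 2); rewrite /int_J; set s := Num.sqrt 2 => s2.
have s0 : 0 <= s by exact: sqrtr_ge0.
have s1 : 1 < s by nra.
have sl2 : s < 2 by nra.
(* The positive root of r^2 + 2 r - 1; [J] equals 4 up to it. *)
pose rho := s - 1.
have rho0 : 0 < rho by rewrite /rho; lra.
have rho1 : rho <= 1 by rewrite /rho; lra.
have A1 : has_area (@J R) 0 rho (4 * rho).
  have E x : 0 <= x -> x <= rho -> J x = 4.
    move=> x0 xr; rewrite /J max0_l ?expr0n ?mul0r ?subr0//=.
    by move: xr; rewrite /rho => xr; nra.
  have -> : 4 * rho = (rho - 0) * (J 0 + 4 * J ((0 + rho) / 2) + J rho) / 6.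
    by rewrite !E//; lra.
  apply: (@has_area_quadratic _ _ _ _ 0 0 4); first exact: ltW.
    by apply: (@nonincr_sub _ _ _ _ 0 1) => //; exact: J_nonincr.
  by move=> x /andP[x0 xr]; rewrite E//; ring.
(* Termwise antiderivative, from (x^2 + 2 x - 1)^3 / x^4 = x^2 + 6 x + 9 - 4/x - 9/x^2 + 6/x^3 -
   1/x^4. *)
pose G x := 4 * x - 6^-1 * (x ^+ 3 / 3 + 3 * x ^+ 2 + 9 * x - 4 * ln x + 9 * x^-1
   - 3 * x^-1 ^+ 2 + x^-1 ^+ 3 / 3).
have A2 : has_area (@J R) rho 1 (G 1 - G rho).
  apply: has_area_deriv.
    by apply: (@nonincr_sub _ _ _ _ 0 1) => //; [exact: ltW|exact: J_nonincr].
  move=> x /andP[xr x1].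
  have x0 : 0 < x := lt_le_trans rho0 xr.
  have := is_derive1_ln x0 => dln.
  have xn0 : x != 0 by rewrite gt_eqF.
  have dV : is_derive x 1 (fun y => y^-1 : R) (- x ^- 2).
    have := is_deriveV (f:=id) xn0 (is_derive_id x 1).
    by rewrite /GRing.scale/= mulr1.
  rewrite /G.
  apply: is_derive_eq.
  rewrite /J max0_r; last by move: xr; rewrite /rho => xr; nra.
  by rewrite /GRing.scale/=; field.
have -> : 2 / 9 * (4 + 7 * s + 3 * ln (s + 1)) = 4 * rho + (G 1 - G rho).
  have rV : rho^-1 = s + 1.
    apply: (@mulfI _ rho); first by rewrite gt_eqF.
    rewrite divff ?gt_eqF// /rho; lra.
  have -> : ln (s + 1) = - ln rho by rewrite -rV lnV.
  rewrite /G rV ln1 invr1 /rho.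
  have s3 : s ^+ 3 = 2 * s by rewrite exprS s2 mulrC.
  by lra.
apply: (has_area_cat _ _ _ A1 A2) => //; first exact: ltW.
exact: J_nonincr.
Qed.
End AreaJ.

(** * Logarithmic sums and the inversion of a sum over n/m *)

Section LogSums.
Variable R : realType.

(** Both bounds are ln (1 + x) <= x, at x = -1/(m + 1) and at x = 1/m. *)
Lemma ln_succ_bounds m : (0 < m)%N ->
  m.+1%:R^-1 <= (ln m.+1%:R - ln m%:R : R) <= m%:R^-1.
Proof.
move=> m0.
have p0 : 0 < m%:R :> R by rewrite ltr0n.
have p1 : 0 < m.+1%:R :> R by rewrite ltr0n.
rewrite -ln_div ?posrE//; apply/andP; split.
  rewrite -[leRHS]opprK -lnV ?posrE ?divr_gt0// invf_div lerNr.
  have -> : m%:R / m.+1%:R = 1 + - m.+1%:R^-1 :> R.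
    by rewrite -[in LHS](addrK 1 m%:R) natr1 mulrBl divff ?gt_eqF// mul1r.
  by apply: le_ln1Dx; rewrite ltrN2 invf_lt1// ltr1n.
have -> : m.+1%:R / m%:R = 1 + m%:R^-1 :> R.
  by rewrite -natr1 mulrDl divff ?gt_eqF// mul1r.
by apply: le_ln1Dx; rewrite (lt_trans (ltrN10 R))// invr_gt0.
Qed.

Lemma harmonic_sum_ln n : (0 < n)%N ->
  ln n%:R <= (\sum_(1 <= u < n.+1) u%:R^-1 : R) <= ln n%:R + 1.
Proof.
move=> n0; apply/andP; split.
  apply: (@le_trans _ _ (ln n.+1%:R)).
    by rewrite ler_ln ?posrE ?ltr0n// ler_nat.
  elim: n {n0} => [|n IHn]; first by rewrite ln1 big_nil.
  have /andP[_ b] := ln_succ_bounds (ltn0Sn n).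
  by rewrite big_nat_recr//= -[leLHS](subrK (ln n.+1%:R)) addrC lerD.
case: n n0 => // n _; elim: n => [|n IHn].
  by rewrite big_nat1 invr1 ln1 add0r.
have /andP[b _] := ln_succ_bounds (ltn0Sn n).
rewrite big_nat_recr//= -[ln n.+2%:R](subrK (ln n.+1%:R)) -addrA [leRHS]addrC.
by rewrite lerD.
Qed.

Lemma sum_ln_over_sqr n :
  \sum_(1 <= m < n.+1) (m%:R ^+ 2)^-1 * ln (2 * m%:R) <= 4 :> R.
Proof.
(* Up to sign an antiderivative of (ln x + 1) / x^2, which dominates ln (2 x) / x^2 since ln 2 <= 1.
   The factor 2 in [step] pays for m (m + 1) <= 2 m^2, and the telescoped total is at most 2 [psi 1]
   = 4. *)
pose psi m : R := (ln m%:R + 2) / m%:R.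
have step m : (0 < m)%N ->
   (m%:R ^+ 2)^-1 * ln (2 * m%:R) <= 2 * (psi m - psi m.+1) :> R.
  move=> m0; have p0 : 0 < m%:R :> R by rewrite ltr0n.
  have p1 : 1 <= m%:R :> R by rewrite ler1n.
  have L0 : 0 <= ln m%:R :> R by rewrite ln_ge0.
  have l2 : ln 2 <= 1 :> R by have := @le_ln1Dx R 1; apply; lra.
  have /andP[_ d1] := ln_succ_bounds m0.
  rewrite lnM ?posrE//.
  apply: (@le_trans _ _ (2 * ((ln m%:R + 1) / (m%:R * (m%:R + 1))))).
    apply: (@le_trans _ _ ((m%:R ^+ 2)^-1 * (ln m%:R + 1))).
      by rewrite ler_wpM2l ?invr_ge0 ?exprn_ge0//; lra.
    rewrite mulrA mulrAC ler_wpM2r//; first by lra.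
    rewrite ler_pdivlMr ?mulr_gt0 ?addr_gt0// mulrC ler_pdivrMr ?exprn_gt0//.
    by rewrite expr2; nra.
  rewrite ler_pM2l// /psi.
  have -> : ln m.+1%:R = ln m%:R + (ln m.+1%:R - ln m%:R) :> R by ring.
  rewrite -natr1 in d1 *; move: d1; set d := _ - _; move: (ln m%:R) L0 => L L0 d1.
  rewrite -subr_ge0.
  have -> : (L + 2) / m%:R - (L + d + 2) / (m%:R + 1) - (L + 1) / (m%:R * (m%:R + 1)) =
     (1 - d * m%:R) / (m%:R * (m%:R + 1)).
    by field; rewrite !gt_eqF// addr_gt0.
  apply: divr_ge0; last by rewrite mulr_ge0 ?addr_ge0.
  rewrite subr_ge0.
  by move: d1; rewrite -[m%:R^-1]mul1r ler_pdivlMr.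
apply: (@le_trans _ _ (\sum_(1 <= m < n.+1) (2 * (psi m - psi m.+1)))).
  by apply: ler_sum_nat => m /andP[m0 _]; apply: step.
rewrite -mulr_sumr.
have -> : \sum_(1 <= i < n.+1) (psi i - psi i.+1) = psi 1%N - psi n.+1.
  have := telescope_sumr (fun i => - psi i) (ltn0Sn n).
  rewrite opprK => h; rewrite [RHS]addrC -h.
  by apply: eq_bigr => i _; rewrite opprK addrC.
have : 0 <= psi n.+1.
  by rewrite /psi divr_ge0// addr_ge0// ln_ge0// ler1n.
have -> : psi 1%N = 2 by rewrite /psi ln1 divr1 add0r.
by lra.
Qed.

(* For [E n := A n - c ln n] the hypothesis bounds the sum of the [E (n %/ m) / m ^ 2];
   isolating the term m = 1, the others have total weight at most 3 / 4. *)
Lemma log_growth_of_divisor_sum (A : nat -> R) (I K : R) : 0 <= I ->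
  (forall n, (0 < n)%N ->
    `|\sum_(1 <= m < n.+1) (m%:R ^+ 2)^-1 * A (n %/ m)%N - I * ln n%:R| <= K) ->
  exists K', forall n, (0 < n)%N ->
    `|A n - I / (pi ^+ 2 / 6) * ln n%:R| <= K'.
Proof.
move=> I0 HA.
pose z : R := pi ^+ 2 / 6.
have z1 : 1 <= z.
  have /andP[] := inv_sqr_sum_bounds R (ltn0Sn 0).
  by rewrite /inv_sqr_sum big_nat1 expr1n invr1.
rewrite -/z; set c := I / z.
have c0 : 0 <= c by rewrite divr_ge0// (le_trans ler01).
have cz : c * z = I by rewrite /c divfK// gt_eqF// (lt_le_trans ltr01).
pose E n := A n - c * ln n%:R.
(* The 5 is 1 + 4: the tail of zeta(2) is at most 1/n and ln n <= n, and the floors cost at most 4,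
   by [sum_ln_over_sqr]. *)
pose K2 := K + 5 * c.
have main n : (0 < n)%N ->
    `|\sum_(1 <= m < n.+1) (m%:R ^+ 2)^-1 * E (n %/ m)%N| <= K2.
  move=> n0.
  have n1 : 1 <= n%:R :> R by rewrite ler1n.
  (* The cost of writing ln n for ln (n %/ m). As n <= 2 m (n %/ m), each difference of logarithms
     is at most ln (2 m). *)
  pose D := \sum_(1 <= m < n.+1) (m%:R ^+ 2)^-1 * (ln n%:R - ln (n %/ m)%N%:R) : R.
  have D0 : 0 <= D.
    rewrite /D big_seq; apply: sumr_ge0 => m; rewrite mem_index_iota => /andP[m0 mn].
    have q0 : (0 < n %/ m)%N by rewrite divn_gt0.
    rewrite mulr_ge0 ?invr_ge0 ?exprn_ge0// subr_ge0 ler_ln ?posrE ?ltr0n//.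
    by rewrite ler_nat leq_div.
  have D4 : D <= 4.
    apply: le_trans (sum_ln_over_sqr n); apply: ler_sum_nat => m /andP[m0 mn].
    have q0 : (0 < n %/ m)%N by rewrite divn_gt0.
    rewrite ler_wpM2l ?invr_ge0 ?exprn_ge0// lerBlDr -lnM ?posrE ?mulr_gt0 ?ltr0n//.
    rewrite ler_ln ?posrE ?mulr_gt0 ?ltr0n// -!natrM ler_nat.
    have := ltn_pmod n m0; have := divn_eq n m.
    by move: q0; set q := (n %/ m)%N; nia.
  have -> : \sum_(1 <= m < n.+1) (m%:R ^+ 2)^-1 * E (n %/ m)%N =
     (\sum_(1 <= m < n.+1) (m%:R ^+ 2)^-1 * A (n %/ m)%N - I * ln n%:R) +
     c * ((z - inv_sqr_sum R n) * ln n%:R + D).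
    have -> : D = inv_sqr_sum R n * ln n%:R -
        \sum_(1 <= m < n.+1) (m%:R ^+ 2)^-1 * ln (n %/ m)%N%:R.
      rewrite /D /inv_sqr_sum mulr_suml -sumrB.
      by apply: eq_bigr => m _; rewrite mulrBr.
    have -> : \sum_(1 <= m < n.+1) (m%:R ^+ 2)^-1 * E (n %/ m)%N =
        \sum_(1 <= m < n.+1) (m%:R ^+ 2)^-1 * A (n %/ m)%N -
        c * \sum_(1 <= m < n.+1) (m%:R ^+ 2)^-1 * ln (n %/ m)%N%:R.
      rewrite mulr_sumr -sumrB.
      by apply: eq_bigr => m _; rewrite mulrBr mulrCA.
    by rewrite -cz; ring.
  have /andP[t1 t2] := inv_sqr_sum_bounds R n0.
  have L0 : 0 <= ln n%:R :> R by rewrite ln_ge0.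
  have Ln : ln n%:R <= n%:R :> R by rewrite ltW// ln_sublinear// ltr0n.
  have T0 : 0 <= (z - inv_sqr_sum R n) * ln n%:R by rewrite mulr_ge0// subr_ge0.
  have T1 : (z - inv_sqr_sum R n) * ln n%:R <= 1.
    apply: (@le_trans _ _ (n%:R^-1 * n%:R)); last by rewrite mulVf// gt_eqF// ltr0n.
    by rewrite ler_pM// ?subr_ge0// lerBlDl.
  apply: le_trans (ler_normD _ _) _; apply: lerD; first exact: HA.
  rewrite normrM (ger0_norm c0) mulrC ler_wpM2r// ger0_norm ?addr_ge0//.
  by lra.
(* This bound reproduces itself: K2 for the whole sum plus 3/4 of 4 K2 for the terms m >= 2. *)
exists (4 * K2); elim/ltn_ind => n IH n0.
rewrite -/(E n).
have -> : E n = \sum_(1 <= m < n.+1) (m%:R ^+ 2)^-1 * E (n %/ m)%N -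
    \sum_(2 <= m < n.+1) (m%:R ^+ 2)^-1 * E (n %/ m)%N.
  by rewrite (@big_ltn _ _ _ 1)// divn1 expr1n invr1 mul1r addrK.
have K20 : 0 <= K2 by apply: le_trans (main 1%N _).
apply: le_trans (ler_normB _ _) _.
suff : `|\sum_(2 <= m < n.+1) (m%:R ^+ 2)^-1 * E (n %/ m)%N| <= 3 / 4 * (4 * K2).
  by have := main n n0; lra.
apply: le_trans (ler_norm_sum _ _ _) _.
apply: (@le_trans _ _ (\sum_(2 <= m < n.+1) (m%:R ^+ 2)^-1 * (4 * K2))).
  apply: ler_sum_nat => m /andP[m2 mn].
  rewrite normrM ger0_norm ?invr_ge0 ?exprn_ge0// ler_wpM2l ?invr_ge0 ?exprn_ge0//.
  apply: IH; last by rewrite divn_gt0// (leq_trans _ m2).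
  by rewrite ltn_Pdiv.
rewrite -mulr_suml ler_wpM2r ?mulr_ge0//.
(* The weights from m = 2 on add up to at most 1/4 + 1/2. *)
have := @inv_sqr_sum_le R n 2 isT.
have := @inv_sqr_sum_le R 2 2 isT (leqnn _).
case: n n0 {IH} => // -[_ _ _|n _ _ /(_ isT)]; first by rewrite big_nil; lra.
rewrite /inv_sqr_sum !(@big_ltn _ _ _ 1)// expr1n invr1.
rewrite [X in 1 + X <= _ <= _]big_nat1 [X in _ <= _ <= 1 + X + _]big_nat1.
by move=> /andP[_ h]; lra.
Qed.
End LogSums.

(** * Logarithmic growth of the coprime sum *)

Section CoprimeSum.
Variable R : realType.

Definition coprime_J_sum n : R := \sum_(1 <= u < n.+1)
  \sum_(1 <= v < u | coprime u v) J (v%:R / u%:R) / u%:R ^+ 2.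

Lemma int_J_bounds : 0 <= int_J R <= 4.
Proof.
have [P /(_ 0 1 (lexx _) ler01 (lexx _)) HP HI] := has_area_J R.
have /andP[j0 _] := @J_bounds R 1 ltac:(rewrite ler01 lexx//).
have /andP[_ j4] := @J_bounds R 0 ltac:(rewrite ler01 lexx//).
by move: HP; rewrite HI subr0 !mulr1 => /andP[p q]; rewrite (le_trans j0 p) (le_trans q j4).
Qed.

(** Riemann sums of step 1/u for the monotone [J]; the end terms to be added or removed lie between
    0 and 4. *)
Lemma sum_J_approx u : (0 < u)%N ->
  `|\sum_(1 <= v < u) J (v%:R / u%:R) - u%:R * int_J R| <= 4.
Proof.
move=> u0.
have p0 : 0 < u%:R :> R by rewrite ltr0n.
have := @has_area_riemann R (@J R) (int_J R) (u%:R^-1) u.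
rewrite divff ?gt_eqF// invr_ge0 => /(_ (ltW p0) (has_area_J R)) /andP[].
rewrite big_nat_recr//= divff ?gt_eqF// (@big_ltn _ _ _ 0)// mul0r.
rewrite ler_pdivrMl// ler_pdivlMl//.
have /andP[j0 _] := @J_bounds R 1 ltac:(rewrite ler01 lexx//).
have /andP[_ j4] := @J_bounds R 0 ltac:(rewrite ler01 lexx//).
by move=> h1 h2; rewrite ler_norml; apply/andP; split; lra.
Qed.

(** The summand is homogeneous of degree -2 in (u, v), so grouping by the gcd m takes out 1/m^2. *)
Lemma sum_J_by_gcd n :
  \sum_(1 <= m < n.+1) (m%:R ^+ 2)^-1 * coprime_J_sum (n %/ m)%N =
  \sum_(1 <= u < n.+1) \sum_(1 <= v < u) J (v%:R / u%:R) / u%:R ^+ 2 :> R.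
Proof.
rewrite (sum_by_gcd n (fun u v => J (v%:R / u%:R) / u%:R ^+ 2 : R)).
apply: eq_big_nat => m /andP[m0 _].
have p0 : m%:R != 0 :> R by rewrite pnatr_eq0 -lt0n.
rewrite /coprime_J_sum mulr_sumr; apply: eq_big_nat => u /andP[u0 _].
have q0 : u%:R != 0 :> R by rewrite pnatr_eq0 -lt0n.
rewrite mulr_sumr; apply: eq_bigr => v _.
by rewrite !natrM -mulf_div divff// mul1r exprMn mulrCA [X in _ = _ * X]invfM.
Qed.

Lemma coprime_J_sum_asymp : exists K, forall n, (0 < n)%N ->
  `|coprime_J_sum n - int_J R / (pi ^+ 2 / 6) * ln n%:R| <= K.
Proof.
have /andP[I0 I4] := int_J_bounds.
(* Here 12 = 8 + 4: the Riemann errors total at most the sum of 4 / u^2, hence 8, and the harmonic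
   sum, within 1 of ln n, has a coefficient at most 4. *)
apply: (@log_growth_of_divisor_sum R coprime_J_sum (int_J R) 12) => // n n0.
rewrite sum_J_by_gcd.
have /andP[h1 h2] := harmonic_sum_ln R n0.
have -> : \sum_(1 <= u < n.+1) \sum_(1 <= v < u) J (v%:R / u%:R) / u%:R ^+ 2 =
   \sum_(1 <= u < n.+1) (\sum_(1 <= v < u) J (v%:R / u%:R) - u%:R * int_J R) / u%:R ^+ 2 +
   int_J R * \sum_(1 <= u < n.+1) u%:R^-1 :> R.
  rewrite mulr_sumr -big_split/=; apply: eq_big_nat => u /andP[u0 _].
  have q0 : u%:R != 0 :> R by rewrite pnatr_eq0 -lt0n.
  by rewrite -mulr_suml mulrBl; field.
set S := \sum_(1 <= u < n.+1) _ / _; set H := \sum_(1 <= u < n.+1) _ in h1 h2 *.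
have HS : `|S| <= 8.
  apply: le_trans (ler_norm_sum _ _ _) _.
  apply: (@le_trans _ _ (4 * inv_sqr_sum R n)).
    rewrite /inv_sqr_sum mulr_sumr; apply: ler_sum_nat => u /andP[u0 _].
    rewrite normrM [X in _ * X]ger0_norm ?invr_ge0 ?exprn_ge0//.
    by rewrite ler_wpM2r ?invr_ge0 ?exprn_ge0// sum_J_approx.
  have := @inv_sqr_sum_le R n 1 isT n0.
  have -> : inv_sqr_sum R 1 = 1 by rewrite /inv_sqr_sum big_nat1 expr1n invr1.
  by rewrite invr1 => /andP[_ h]; lra.
rewrite -addrA; apply: le_trans (ler_normD _ _) _.
rewrite -mulrBr normrM (ger0_norm I0).
have : `|H - ln n%:R| <= 1 by rewrite ler_norml; apply/andP; split; lra.
have : 0 <= `|H - ln n%:R| by [].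
by nra.
Qed.
End CoprimeSum.

(** * Lattice points in intervals *)

Section LatticeCount.

(* When [l - k - 1] or [k - l] is truncated to 0 it counts no m, as it should:
   no m >= 1 satisfies m v <= 0. *)
Lemma sum_sign_count_v k l u v : (0 < v)%N -> (v < u)%N -> (
  \sum_(1 <= m < (k %/ u).+1) sign_count k l (m * v) + minn (k %/ u) ((l - k - 1) %/ v) =
  k %/ u + minn (k %/ u) ((k - l) %/ v))%N.
Proof.
move=> v0 vu.
have e : (\sum_(1 <= m < (k %/ u).+1) 1 = k %/ u)%N.
  by rewrite sum_nat_const_nat subn1 muln1.
rewrite -[X in _ = (X + _)%N]e -!sum_leq_mul// -!big_split/=.
apply: eq_big_nat => m /andP[m0]; rewrite ltnS.
rewrite leq_divRL ?(leq_ltn_trans _ vu)// => mk.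
have h1 : (0 < m * v)%N by rewrite muln_gt0 m0.
have h2 : (m * v <= k)%N by apply: leq_trans mk; rewrite leq_mul2l (ltnW vu) orbT.
move: (m * v)%N h1 h2 => z h1 h2; rewrite /sign_count; lia.
Qed.

Lemma sum_sign_count_u k l u v : (0 < v)%N -> (v < u)%N -> (
  \sum_(1 <= n < (k %/ v).+1) sign_count k l (n * u) + minn (k %/ v) ((l - k - 1) %/ u) =
  minn (k %/ v) ((k + l) %/ u) + minn (k %/ v) ((k - l) %/ u))%N.
Proof.
move=> v0 vu; have u0 : (0 < u)%N by rewrite (leq_ltn_trans _ vu).
rewrite -!sum_leq_mul// -!big_split/=; apply: eq_big_nat => n /andP[n0 _].
have h1 : (0 < n * u)%N by rewrite muln_gt0 n0.
move: (n * u)%N h1 => z h1; rewrite /sign_count; lia.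
Qed.

Variable R : realType.

Lemma divn_approx (t v : nat) (x e : R) : (0 < v)%N ->
  x - e <= t%:R <= x -> x / v%:R - (1 + e) <= (t %/ v)%N%:R <= x / v%:R.
Proof.
move=> v0 /andP[h1 h2].
have p0 : 0 < v%:R :> R by rewrite ltr0n.
have p1 : 1 <= v%:R :> R by rewrite ler1n.
have e0 : 0 <= e by lra.
have d : t%:R = (t %/ v)%N%:R * v%:R + (t %% v)%N%:R :> R.
  by rewrite -natrM -natrD -divn_eq.
have m0 : 0 <= (t %% v)%N%:R :> R by [].
have m1 : (t %% v)%N%:R <= v%:R :> R by rewrite ler_nat ltnW// ltn_pmod.
apply/andP; split; last by rewrite ler_pdivlMr//; lra.
rewrite lerBlDr ler_pdivrMr// !mulrDl mul1r.
have : e <= e * v%:R by rewrite ler_peMr.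
by lra.
Qed.

Lemma min_approx (a b a' b' e : R) :
  a - e <= a' <= a -> b - e <= b' <= b ->
  Num.min a b - e <= Num.min a' b' <= Num.min a b.
Proof.
move=> /andP[p1 p2] /andP[q1 q2]; rewrite le_min2// andbT.
by rewrite addr_minl le_min2.
Qed.

Lemma sub_max0_approx (k l : nat) :
  Num.max 0 (l%:R - k%:R) - 1 <= ((l - k - 1)%N%:R : R) <= Num.max 0 (l%:R - k%:R).
Proof.
have [lk|kl] := leqP l k.
  have -> : (l - k - 1 = 0)%N by lia.
  by rewrite max0_l ?subr_le0 ?ler_nat//; apply/andP; split; lra.
have -> : (l - k - 1)%N%:R = l%:R - k%:R - 1 :> R by rewrite !natrB//; lia.
rewrite max0_r ?lexx ?subr_ge0 ?ler_nat ?(ltnW kl)//=.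
by rewrite gerBl.
Qed.

Lemma sub_max0 (k l : nat) : (k - l)%N%:R = Num.max 0 (k%:R - l%:R) :> R.
Proof.
have [kl|lk] := leqP k l.
  by rewrite max0_l ?subr_le0 ?ler_nat//; move: kl; rewrite -subn_eq0 => /eqP ->.
by rewrite natrB ?(ltnW lk)// max0_r// subr_ge0 ler_nat ltnW.
Qed.

Lemma natr_minn (a b : nat) : (minn a b)%:R = Num.min a%:R b%:R :> R.
Proof.
have [ab|ba] := leqP a b; first by rewrite min_l// ler_nat.
by rewrite min_r// ler_nat ltnW.
Qed.

Section Approx.
Variables k l u v : nat.
Hypotheses (v0 : (0 < v)%N) (vu : (v < u)%N) (uk : (u <= k)%N) (lk : (l <= 2 * k)%N).

Let A : R := (\sum_(1 <= m < (k %/ u).+1) sign_count k l (m * v))%N%:R.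
Let B : R := (\sum_(1 <= n < (k %/ v).+1) sign_count k l (n * u))%N%:R.
Let X : R := k%:R / u%:R.

Let P1 : R := Num.max 0 (l%:R - k%:R).
Let P2 : R := Num.max 0 (k%:R - l%:R).

(** The floors are removed from [sum_sign_count_v]. The three terms are known up to 1, 2 and 1; the
    2 is a floor together with the -1 in l - k - 1. *)
Lemma approx_A : `|A - X * len1 (l%:R / k%:R) (v%:R / u%:R)| <= 4.
Proof.
have u0 : (0 < u)%N by rewrite (leq_ltn_trans _ vu).
have k0 : (0 < k)%N by rewrite (leq_trans u0).
have [vr ur kr] : [/\ 0 < v%:R :> R, 0 < u%:R :> R & 0 < k%:R :> R] by rewrite !ltr0n.
have -> : X * len1 (l%:R / k%:R) (v%:R / u%:R) =
    X - Num.min X (P1 / v%:R) + Num.min X (P2 / v%:R).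
  have X0 : 0 <= X by rewrite divr_ge0 ?ltW.
  have c0 : 0 <= k%:R / v%:R :> R by rewrite divr_ge0 ?ltW.
  have e (y : R) : X * (Num.max 0 y / (v%:R / u%:R)) = Num.max 0 (k%:R * y) / v%:R.
    have -> : Num.max 0 (k%:R * y) = k%:R * Num.max 0 y by rewrite maxr_pMr ?mulr0// ltW.
    by rewrite /X; field; rewrite !gt_eqF.
  rewrite /len1 mulrDr mulrBr !minr_pMr// !mulr1 !e.
  have ek : k%:R * (l%:R / k%:R) = l%:R :> R by rewrite mulrC divfK// gt_eqF.
  by rewrite !mulrBr mulr1 ek.
have := sum_sign_count_v k l v0 vu.
move/(congr1 (fun n => n%:R : R)); rewrite !natrD !natr_minn -/A.
have q := @divn_approx k u k%:R 0 u0.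
have /q {}q : k%:R - 0 <= (k%:R : R) <= k%:R by rewrite subr0 lexx.
have a := divn_approx v0 (sub_max0_approx k l).
have b : P2 - 0 <= (k - l)%N%:R <= P2 by rewrite sub_max0 subr0 lexx.
have {}b := divn_approx v0 b.
rewrite -/X -/P1 in q a *.
have /andP[m1 m2] : Num.min X (P1 / v%:R) - 2 <=
   Num.min (k %/ u)%N%:R ((l - k - 1) %/ v)%N%:R <= Num.min X (P1 / v%:R).
  by apply: min_approx; [case/andP: q; lra|case/andP: a; lra].
have /andP[m3 m4] : Num.min X (P2 / v%:R) - 1 <=
   Num.min (k %/ u)%N%:R ((k - l) %/ v)%N%:R <= Num.min X (P2 / v%:R).
  by apply: min_approx; [case/andP: q; lra|case/andP: b; lra].
case/andP: q => q1 q2 E.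
by rewrite ler_norml; apply/andP; split; lra.
Qed.

(** As l <= 2 k, both [P1] and [P2] are at most k, so their quotients by u never reach the cap k /
    v; their difference k - l then gives the term 1 - l of [len2]. *)
Lemma approx_B : `|B - X * len2 (l%:R / k%:R) (v%:R / u%:R)| <= 4.
Proof.
have u0 : (0 < u)%N by rewrite (leq_ltn_trans _ vu).
have k0 : (0 < k)%N by rewrite (leq_trans u0).
have [vr ur kr] : [/\ 0 < v%:R :> R, 0 < u%:R :> R & 0 < k%:R :> R] by rewrite !ltr0n.
have lkr : l%:R <= 2 * k%:R :> R by rewrite -natrM ler_nat.
have l0 : 0 <= l%:R :> R by [].
pose Y : R := k%:R / v%:R.
have XY : X <= Y by rewrite /X /Y ler_pM2l// lef_pV2 ?posrE// ler_nat ltnW.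
have P1k : P1 <= k%:R by rewrite ge_max ler0n/= lerBlDr; lra.
have P2k : P2 <= k%:R by rewrite ge_max ler0n/= lerBlDr; lra.
have PP : P2 - P1 = k%:R - l%:R.
  rewrite /P1 /P2; case: (leqP k l) => h.
    by rewrite max0_l ?subr_le0 ?ler_nat// max0_r ?subr_ge0 ?ler_nat//; ring.
  rewrite max0_r ?subr_ge0 ?ler_nat ?(ltnW h)//.
  by rewrite max0_l ?subr_le0 ?ler_nat ?(ltnW h)//; ring.
have -> : X * len2 (l%:R / k%:R) (v%:R / u%:R) =
    Num.min Y ((k + l)%N%:R / u%:R) + Num.min Y (P2 / u%:R) - Num.min Y (P1 / u%:R).
  have X0 : 0 <= X by rewrite divr_ge0 ?ltW.
  have PY z : z <= k%:R -> Num.min Y (z / u%:R) = z / u%:R.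
    move=> zk; rewrite min_r//; apply: le_trans XY.
    by rewrite ler_wpM2r// invr_ge0 ltW.
  rewrite (PY P2)// (PY P1)// -addrA -mulrBl PP.
  rewrite /len2 -addrA mulrDr minr_pMr//; congr (Num.min _ _ + _).
  - by rewrite /X /Y; field; rewrite !gt_eqF.
  - by rewrite natrD /X; field; rewrite !gt_eqF.
  - by rewrite /X; field; rewrite !gt_eqF.
have E := congr1 (fun n => n%:R : R) (sum_sign_count_u k l v0 vu).
rewrite /= !(natrD, natr_minn) -/B in E.
have q := @divn_approx k v k%:R 0 v0.
have /q {}q : k%:R - 0 <= (k%:R : R) <= k%:R by rewrite subr0 lexx.
have a := divn_approx u0 (sub_max0_approx k l).
have b : P2 - 0 <= (k - l)%N%:R <= P2 by rewrite sub_max0 subr0 lexx.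
have {}b := divn_approx u0 b.
have c : (k + l)%N%:R - 0 <= ((k + l)%N%:R : R) <= (k + l)%N%:R by rewrite subr0 lexx.
have {}c := divn_approx u0 c.
rewrite -/Y -/P1 in q a *.
have /andP[m1 m2] : Num.min Y (P1 / u%:R) - 2 <=
   Num.min (k %/ v)%N%:R ((l - k - 1) %/ u)%N%:R <= Num.min Y (P1 / u%:R).
  by apply: min_approx; [case/andP: q; lra|case/andP: a; lra].
have /andP[m3 m4] : Num.min Y (P2 / u%:R) - 1 <=
   Num.min (k %/ v)%N%:R ((k - l) %/ u)%N%:R <= Num.min Y (P2 / u%:R).
  by apply: min_approx; [case/andP: q; lra|case/andP: b; lra].
have /andP[m5 m6] : Num.min Y ((k + l)%N%:R / u%:R) - 1 <=
   Num.min (k %/ v)%N%:R ((k + l) %/ u)%N%:R <= Num.min Y ((k + l)%N%:R / u%:R).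
  by apply: min_approx; [case/andP: q; lra|case/andP: c; lra].
by rewrite ler_norml; apply/andP; split; lra.
Qed.

(** With both factors known up to 4 and both main terms at most 2 X, the product is off by at most
    16 + 8 X + 8 X, and X >= 1 since u <= k. *)
Lemma approx_AB : `|A * B - X ^+ 2 * len12 (v%:R / u%:R) (l%:R / k%:R)| <= 32 * X.
Proof.
have u0 : (0 < u)%N by rewrite (leq_ltn_trans _ vu).
have k0 : (0 < k)%N by rewrite (leq_trans u0).
have [vr ur kr] : [/\ 0 < v%:R :> R, 0 < u%:R :> R & 0 < k%:R :> R] by rewrite !ltr0n.
have X1 : 1 <= X by rewrite ler_pdivlMr// mul1r ler_nat.
have r0 : 0 < v%:R / u%:R :> R by rewrite divr_gt0.
have r1 : v%:R / u%:R < 1 :> R by rewrite ltr_pdivrMr// mul1r ltr_nat.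
have l2 : l%:R / k%:R <= 2 :> R by rewrite ler_pdivrMr// -natrM ler_nat.
have := len1_ge0 (l%:R / k%:R) r0; have := len1_le2 (l%:R / k%:R) r0.
have := len2_ge0 r0 r1 l2; have := len2_le2 (v%:R / u%:R : R) (l%:R / k%:R).
have := approx_A; have := approx_B; rewrite /len12.
move: (len1 _ _) (len2 _ _) => F G; rewrite !ler_norml.
move=> /andP[b1 b2] /andP[a1 a2] g2 g0 h2 h0.
have XF : 0 <= X * F <= 2 * X by apply/andP; split; nra.
have XG : 0 <= X * G <= 2 * X by apply/andP; split; nra.
move: a1 a2 b1 b2; have -> : X ^+ 2 * (F * G) = (X * F) * (X * G) by ring.
move: XF XG; move: (X * F) (X * G) => f g /andP[f0 len1] /andP[g1 g3] a1 a2 b1 b2.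
have -> : A * B - f * g = (A - f) * (B - g) + f * (B - g) + (A - f) * g by ring.
by apply/andP; split; nra.
Qed.

End Approx.
End LatticeCount.

(** * Summation over l, u and v *)

Section QAsymptotics.

(** Both sides run over the pairs with m u <= k. *)
Lemma sum_div_swap (V : nmodType) k (F : nat -> nat -> V) :
  \sum_(1 <= m < k.+1) \sum_(1 <= u < (k %/ m)%N.+1) F m u =
  \sum_(1 <= u < k.+1) \sum_(1 <= m < (k %/ u)%N.+1) F m u.
Proof.
have widen (G : nat -> V) m : (0 < m)%N ->
    \sum_(1 <= u < (k %/ m)%N.+1) G u = \sum_(1 <= u < k.+1 | (m * u <= k)%N) G u.
  move=> m0; rewrite (big_nat_widen _ _ k.+1)/=; last by rewrite ltnS leq_div.
  by apply: eq_bigl => u; rewrite ltnS leq_divRL// mulnC.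
transitivity (\sum_(1 <= m < k.+1) \sum_(1 <= u < k.+1 | (m * u <= k)%N) F m u).
  by apply: eq_big_nat => m /andP[m0 _]; apply: widen.
under eq_bigr do rewrite big_mkcond.
rewrite exchange_big/=; apply: eq_big_nat => u /andP[u0 _].
by rewrite widen// [RHS]big_mkcond; apply: eq_bigr => m _; rewrite mulnC.
Qed.

Lemma coprime_quad_sumE k l :
  coprime_quad_sum k l = (\sum_(1 <= u < k.+1) \sum_(1 <= v < u | coprime u v)
  (\sum_(1 <= m < (k %/ u).+1) sign_count k l (m * v)) *
  (\sum_(1 <= n < (k %/ v).+1) sign_count k l (n * u)))%N.
Proof.
rewrite /coprime_quad_sum (@sum_div_swap nat k (fun m u => \sum_(1 <= v < u | coprime u v)
    sign_count k l (m * v) * \sum_(1 <= n < (k %/ v).+1) sign_count k l (n * u))%N).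
apply: eq_bigr => u _; rewrite exchange_big/=; apply: eq_bigr => v _.
by rewrite big_distrl.
Qed.

Lemma sum_pred_le1 (T : eqType) (s : seq T) (p : pred T) : uniq s ->
  {in s &, forall i j, p i -> p j -> i = j} -> (\sum_(i <- s) p i <= 1)%N.
Proof.
move=> us inj; have [/hasP[i si pi]|/hasPn np] := boolP (has p s); last first.
  by rewrite big_seq big1// => i /np /negbTE ->.
rewrite (big_rem i)//= big_seq big1 ?addn0 ?leq_b1// => j.
rewrite rem_filter// mem_filter/= => /andP[ji sj].
by case pj: (p j) => //; rewrite (inj _ _ sj si pj pi) eqxx in ji.
Qed.

(** Given b, x and c, at most one y solves bc = xy, with weight at most 4. The bound serves at l =
    0, the only value fixed when l and -l are folded together. *)
Lemma quad_sum_le k l : (quad_sum k l <= 12 * k ^ 3)%N.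
Proof.
have -> : (12 * k ^ 3 = \sum_(1 <= b < k.+1) \sum_(1 <= x < (3 * k).+1)
    \sum_(1 <= c < k.+1) 4)%N.
  by rewrite !sum_nat_const_nat !subn1/=; ring.
apply: leq_sum => b _; rewrite [leqLHS]big_seq [leqRHS]big_seq.
apply: leq_sum => x; rewrite mem_index_iota => /andP[x0 _]; apply: leq_sum => c _.
apply: (@leq_trans (\sum_(1 <= y < (3 * k).+1) (b * c == x * y) * 4)%N).
  by apply: leq_sum => y _; rewrite leq_mul2l (leq_mul (sign_count_le2 _ _ _) (sign_count_le2 _ _ _)) orbT.
rewrite -big_distrl/= -[leqRHS]mul1n leq_mul2r/=.
apply: sum_pred_le1; first exact: iota_uniq.
by move=> y y' _ _ /eqP -> /eqP; move/eqP; rewrite eqn_pmul2l// => /eqP.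
Qed.

Variable R : realType.

Lemma sum_len12_approx (k u v : nat) : (0 < k)%N -> (0 < v)%N -> (v < u)%N ->
  `|\sum_(0 <= l < (2 * k).+1) len12 (v%:R / u%:R) (l%:R / k%:R) -
    k%:R * J (v%:R / u%:R)| <= 4 :> R.
Proof.
move=> k0 v0 vu; have u0 : (0 < u)%N by rewrite (leq_ltn_trans _ vu).
have [vr ur kr] : [/\ 0 < v%:R :> R, 0 < u%:R :> R & 0 < k%:R :> R] by rewrite !ltr0n.
have r0 : 0 < v%:R / u%:R :> R by rewrite divr_gt0.
have r1 : v%:R / u%:R < 1 :> R by rewrite ltr_pdivrMr// mul1r ltr_nat.
have e2 : (2 * k)%N%:R * k%:R^-1 = 2 :> R by rewrite natrM mulfK// gt_eqF.
have := @has_area_riemann R (len12 (v%:R / u%:R)) (J (v%:R / u%:R)) (k%:R^-1) (2 * k).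
rewrite e2 invr_ge0 => /(_ (ltW kr) (has_area_len12 r0 r1)) /andP[].
rewrite ler_pdivrMl// ler_pdivlMl// => h1 h2.
have /andP[z0 z4] := len12_bounds r0 r1 (ler0n R 2).
have t2 : (2 * k)%N%:R / k%:R <= 2 :> R by rewrite e2.
have /andP[y0 y4] := len12_bounds r0 r1 t2.
rewrite ler_norml; apply/andP; split.
  by rewrite big_nat_recr//=; lra.
by rewrite (@big_ltn _ _ _ 0)// mul0r; lra.
Qed.

(** For each pair (u, v) the 2 k + 1 values of l cost 32 k / u each and the Riemann sum over l costs
    4 (k / u)^2, in all at most 100 k^2 / u. There are fewer than u values of v, so each u
    contributes O(k^2) and the errors produce no logarithm. *)
Lemma sum_coprime_quad_sum_approx k : (0 < k)%N ->
  `|\sum_(0 <= l < (2 * k).+1) (coprime_quad_sum k l)%:R - k%:R ^+ 3 * coprime_J_sum R k| <=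
  100 * k%:R ^+ 3.
Proof.
move=> k0; have kr : 0 < k%:R :> R by rewrite ltr0n.
have k1 : 1 <= k%:R :> R by rewrite ler1n.
pose A l u v : R := (\sum_(1 <= m < (k %/ u).+1) sign_count k l (m * v))%N%:R.
pose B l u v : R := (\sum_(1 <= n < (k %/ v).+1) sign_count k l (n * u))%N%:R.
have -> : \sum_(0 <= l < (2 * k).+1) (coprime_quad_sum k l)%:R =
    \sum_(1 <= u < k.+1) \sum_(1 <= v < u | coprime u v)
      \sum_(0 <= l < (2 * k).+1) A l u v * B l u v :> R.
  under eq_bigr do rewrite coprime_quad_sumE natr_sum.
  rewrite exchange_big/=; apply: eq_bigr => u _.
  under eq_bigr do rewrite natr_sum.
  rewrite exchange_big/=; apply: eq_bigr => v _.
  by apply: eq_bigr => l _; rewrite natrM.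
rewrite /coprime_J_sum mulr_sumr -sumrB.
apply: le_trans (ler_norm_sum _ _ _) _.
have -> : 100 * k%:R ^+ 3 = \sum_(1 <= u < k.+1) 100 * k%:R ^+ 2 :> R.
  by rewrite sumr_const_nat subn1/= -[RHS]mulr_natr; ring.
apply: ler_sum_nat => u /andP[u0]; rewrite ltnS => uk.
have ur : 0 < u%:R :> R by rewrite ltr0n.
have u1 : 1 <= u%:R :> R by rewrite ler1n.
rewrite mulr_sumr -sumrB; apply: le_trans (ler_norm_sum _ _ _) _.
apply: (@le_trans _ _ (\sum_(1 <= v < u) 100 * k%:R ^+ 2 / u%:R)); last first.
  rewrite sumr_const_nat -[leLHS]mulr_natr -mulrA; apply: ler_piMr.
    by rewrite mulr_ge0// exprn_ge0.
  by rewrite mulrC ler_pdivrMr// mul1r ler_nat leq_subr.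
rewrite big_mkcond/=; apply: ler_sum_nat => v /andP[v0 vu].
case: ifP => _; last by rewrite divr_ge0// mulr_ge0// exprn_ge0.
have -> : \sum_(0 <= l < (2 * k).+1) A l u v * B l u v -
    k%:R ^+ 3 * (J (v%:R / u%:R) / u%:R ^+ 2) =
  \sum_(0 <= l < (2 * k).+1) (A l u v * B l u v -
     (k%:R / u%:R) ^+ 2 * len12 (v%:R / u%:R) (l%:R / k%:R)) +
  (k%:R / u%:R) ^+ 2 * (\sum_(0 <= l < (2 * k).+1) len12 (v%:R / u%:R) (l%:R / k%:R) -
    k%:R * J (v%:R / u%:R)).
  rewrite sumrB mulrBr mulr_sumr addrA subrK; congr (_ - _).
  by field; rewrite gt_eqF.
apply: le_trans (ler_normD _ _) _.
apply: (@le_trans _ _ ((2 * k).+1%:R * (32 * (k%:R / u%:R)) + (k%:R / u%:R) ^+ 2 * 4)).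
  apply: lerD.
    apply: le_trans (ler_norm_sum _ _ _) _.
    apply: (@le_trans _ _ (\sum_(0 <= l < (2 * k).+1) 32 * (k%:R / u%:R))).
      apply: ler_sum_nat => l /andP[_]; rewrite ltnS => lk.
      exact: approx_AB.
    by rewrite sumr_const_nat subn0 -[leLHS]mulr_natl.
  rewrite normrM ger0_norm ?exprn_ge0 ?divr_ge0//.
  by rewrite ler_wpM2l ?exprn_ge0 ?divr_ge0// sum_len12_approx.
have -> : (2 * k).+1%:R = 2 * k%:R + 1 :> R by rewrite -natr1 natrM.
have -> : 100 * k%:R ^+ 2 / u%:R = 100 * (k%:R * (k%:R / u%:R)) :> R.
  by rewrite expr2 !mulrA.
set X := k%:R / u%:R.
have X0 : 0 <= X by rewrite divr_ge0.
have Xk : X <= k%:R by rewrite ler_pdivrMr// ler_peMr.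
by nra.
Qed.

(** Here 212 = 2 * 100 + 12: the diagonal x = b adds at most 4 k^2 for each l, and (2 k + 1) 4 k^2
    <= 12 k^3. *)
Lemma sum_quad_sum_approx k : (0 < k)%N ->
  `|\sum_(0 <= l < (2 * k).+1) (quad_sum k l)%:R - 2 * k%:R ^+ 3 * coprime_J_sum R k| <=
  212 * k%:R ^+ 3.
Proof.
move=> k0; have k1 : 1 <= k%:R :> R by rewrite ler1n.
have := sum_coprime_quad_sum_approx k0.
have : 2 * \sum_(0 <= l < (2 * k).+1) (coprime_quad_sum k l)%:R <=
    (\sum_(0 <= l < (2 * k).+1) (quad_sum k l)%:R : R) <=
    2 * \sum_(0 <= l < (2 * k).+1) (coprime_quad_sum k l)%:R + 12 * k%:R ^+ 3.
  apply/andP; split.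
    rewrite mulr_sumr; apply: ler_sum_nat => l /andP[_]; rewrite ltnS => lk.
    by rewrite -natrM ler_nat; case/andP: (quad_sum_split lk).
  apply: (@le_trans _ _ (\sum_(0 <= l < (2 * k).+1)
      (2 * (coprime_quad_sum k l)%:R + 4 * k%:R ^+ 2))).
    apply: ler_sum_nat => l /andP[_]; rewrite ltnS => lk.
    by rewrite -natrX -!natrM -natrD ler_nat; case/andP: (quad_sum_split lk).
  rewrite big_split/= mulr_sumr lerD2l sumr_const_nat subn0 -[leLHS]mulr_natr.
  have -> : (2 * k).+1%:R = 2 * k%:R + 1 :> R by rewrite -natr1 natrM.
  rewrite [k%:R ^+ 3]exprS; have : 0 <= k%:R ^+ 2 * (k%:R - 1) :> R.
    by rewrite mulr_ge0 ?exprn_ge0 ?subr_ge0.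
  by lra.
rewrite !ler_norml => /andP[h1 h2] /andP[h3 h4].
by apply/andP; split; lra.
Qed.

End QAsymptotics.

(** * From matrices to solutions of bc = xy *)

Section IntCount.

Definition int_range (n : nat) : seq int := [seq (i%:Z - n%:Z) | i <- iota 0 (2 * n).+1].

Lemma mem_int_range n z : (z \in int_range n) = (`|z| <= n%:Z).
Proof.
apply/mapP/idP => [[i]|zn].
  by rewrite mem_iota => /andP[_ ilt] ->; lia.
exists (absz (z + n%:Z)); last by lia.
by rewrite mem_iota; lia.
Qed.

Lemma int_range_uniq n : uniq (int_range n).
Proof. by rewrite map_inj_uniq ?iota_uniq// => i j; lia. Qed.

Lemma size_int_range n : size (int_range n) = (2 * n).+1.
Proof. by rewrite size_map size_iota. Qed.

Definition eig_eq (a b c d x : int) : bool := (a - x) * (d - x) == b * c.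
(** The quantity (a - d)^2 + 4 b c is the discriminant of the characteristic polynomial. *)
Definition disc_eq0 (a b c d : int) : bool := (a - d) ^+ 2 + 4 * (b * c) == 0.

(** If |x| > 2 k, then |a - x| and |d - x| both exceed k, so their product exceeds k^2 >= |bc|. *)
Lemma eig_eq_bound (k : nat) a b c d x : `|a| <= k%:Z -> `|b| <= k%:Z ->
  `|c| <= k%:Z -> `|d| <= k%:Z -> eig_eq a b c d x -> `|x| <= (2 * k)%:Z.
Proof.
move=> ha hb hc hd /eqP e.
have bc : `|b * c| <= k%:Z * k%:Z by rewrite normrM ler_pM.
have [//|xk] := leP `|x| (2 * k)%N%:Z.
have ax : k%:Z + 1 <= `|a - x| by lia.
have dx : k%:Z + 1 <= `|d - x| by lia.
have : (k%:Z + 1) * (k%:Z + 1) <= `|(a - x) * (d - x)| by rewrite normrM ler_pM//; lia.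
by rewrite e; nia.
Qed.

Lemma eig_eq_other a b c d x y : eig_eq a b c d x ->
  eig_eq a b c d y = (y == x) || (y == a + d - x).
Proof.
move=> /eqP e; rewrite /eig_eq -e -subr_eq0.
have -> : (a - y) * (d - y) - (a - x) * (d - x) = (y - x) * (y - (a + d - x)) by ring.
by rewrite mulf_eq0 !subr_eq0.
Qed.

Local Open Scope nat_scope.

Lemma sum_int_range_eq1 n z : z \in int_range n -> \sum_(x <- int_range n) (x == z) = 1.
Proof.
by move=> zn; rewrite -big_mkcond/= sum1_count count_uniq_mem ?int_range_uniq// zn.
Qed.

(** An integer eigenvalue x brings the second one, a + d - x, in the same range. So the number of
    eigenvalues is 0 or 2 unless these coincide, and then the discriminant vanishes. *)
Lemma count_eig_range k a b c d :
  a \in int_range k -> b \in int_range k -> c \in int_range k -> d \in int_range k ->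
  \sum_(x <- int_range (2 * k)) eig_eq a b c d x <= 2 * has (eig_eq a b c d) (int_range (2 * k)) <=
  \sum_(x <- int_range (2 * k)) eig_eq a b c d x + disc_eq0 a b c d.
Proof.
rewrite !mem_int_range => ha hb hc hd.
have [/hasP[x xk px]|/hasPn np] := boolP (has _ _); last first.
  by rewrite big_seq big1// => x /np /negbTE ->.
have pE y := eig_eq_other y px.
set x' := (a + d - x)%R in pE.
have x'k : x' \in int_range (2 * k).
  by rewrite mem_int_range; apply: (@eig_eq_bound k a b c d) => //; rewrite pE eqxx orbT.
have e1 := sum_int_range_eq1 xk; have e2 := sum_int_range_eq1 x'k.
have [xx|xx] := eqVneq x x'.
  have -> : \sum_(y <- int_range (2 * k)) eig_eq a b c d y = 1.
    by rewrite -[RHS]e1; apply: eq_bigr => y _; rewrite pE -xx orbb.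
  suff -> : disc_eq0 a b c d by [].
  have e := eqP px.
  by rewrite /disc_eq0 -e; apply/eqP; move: xx; rewrite /x' => xx; nia.
have -> : \sum_(y <- int_range (2 * k)) eig_eq a b c d y = 2.
  rewrite -[RHS]/(1 + 1) -[X in _ = X + _]e1 -[X in _ = _ + X]e2.
  rewrite -big_split/=; apply: eq_bigr => y _; rewrite pE.
  case: eqP => [->|]; case: eqP => //.
  by move=> h; rewrite h eqxx in xx.
by rewrite leq_addr.
Qed.

Definition int_eig_count k :=
  \sum_(a <- int_range k) \sum_(b <- int_range k) \sum_(c <- int_range k)
  \sum_(d <- int_range k) has (eig_eq a b c d) (int_range (2 * k)).
Definition eig_pair_count k :=
  \sum_(a <- int_range k) \sum_(b <- int_range k) \sum_(c <- int_range k)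
  \sum_(d <- int_range k) \sum_(x <- int_range (2 * k)) eig_eq a b c d x.

Lemma sum_int_range_const n m : \sum_(x <- int_range n) m = (2 * n).+1 * m.
Proof. by rewrite big_const_seq count_predT size_int_range iter_addn_0 mulnC. Qed.

(** If b is nonzero, then a, b and d determine c; if b = 0, then a = d. Each case leaves three free
    entries. *)
Lemma count_disc_eq0 k : \sum_(a <- int_range k) \sum_(b <- int_range k) \sum_(c <- int_range k)
  \sum_(d <- int_range k) disc_eq0 a b c d <= 2 * (2 * k).+1 ^ 3.
Proof.
apply: (@leq_trans (\sum_(a <- int_range k) \sum_(b <- int_range k) \sum_(c <- int_range k)
  \sum_(d <- int_range k) ((b != 0%R) && disc_eq0 a b c d + (a == d)))).
  apply: leq_sum => a _; apply: leq_sum => b _; apply: leq_sum => c _.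
  apply: leq_sum => d _.
  have [->|_] := eqVneq b 0%R; last by rewrite leq_addr.
  by rewrite /disc_eq0 mul0r mulr0 addr0 expf_eq0 subr_eq0.
have -> : 2 * (2 * k).+1 ^ 3 = \sum_(a <- int_range k) \sum_(b <- int_range k)
   (\sum_(d <- int_range k) 1 + \sum_(c <- int_range k) 1).
  by rewrite !sum_int_range_const; ring.
apply: leq_sum => a _; apply: leq_sum => b _.
under eq_bigr do rewrite big_split/=.
rewrite big_split/= leq_add//.
  rewrite exchange_big/=; apply: leq_sum => d _.
  apply: sum_pred_le1; first exact: int_range_uniq.
  move=> c c' _ _ /andP[b0 /eqP e] /andP[_ /eqP e'].
  by apply: (mulfI b0); lia.
apply: leq_sum => c _; apply: sum_pred_le1; first exact: int_range_uniq.
by move=> d d' _ _ /eqP <- /eqP <-.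
Qed.

Lemma int_eig_count_pairs k :
  eig_pair_count k <= 2 * int_eig_count k <= eig_pair_count k + 2 * (2 * k).+1 ^ 3.
Proof.
rewrite /int_eig_count /eig_pair_count big_distrr/=.
under [X in _ <= X <= _]eq_bigr do (rewrite big_distrr/=;
  under eq_bigr do (rewrite big_distrr/=; under eq_bigr do rewrite big_distrr/=)).
apply/andP; split.
  rewrite big_seq [leqRHS]big_seq; apply: leq_sum => a ha.
  rewrite big_seq [leqRHS]big_seq; apply: leq_sum => b hb.
  rewrite big_seq [leqRHS]big_seq; apply: leq_sum => c hc.
  rewrite big_seq [leqRHS]big_seq; apply: leq_sum => d hd.
  by case/andP: (count_eig_range ha hb hc hd).
apply: leq_trans (leq_add (leqnn _) (count_disc_eq0 k)).
rewrite -big_split/= big_seq [leqRHS]big_seq; apply: leq_sum => a ha.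
rewrite -big_split/= big_seq [leqRHS]big_seq; apply: leq_sum => b hb.
rewrite -big_split/= big_seq [leqRHS]big_seq; apply: leq_sum => c hc.
rewrite -big_split/= big_seq [leqRHS]big_seq; apply: leq_sum => d hd.
by case/andP: (count_eig_range ha hb hc hd).
Qed.

Lemma sum_int_range (V : nmodType) n (F : int -> V) : (\sum_(z <- int_range n) F z =
  F 0 + \sum_(1 <= i < n.+1) (F i%:Z + F (- i%:Z)))%R.
Proof.
rewrite big_map -[iota _ _]/(index_iota 0 (2 * n).+1).
rewrite (@big_cat_nat _ _ _ n)//=; last by lia.
rewrite [X in (_ + X)%R]big_ltn; last by lia.
rewrite subrr addrCA big_split/= [X in (_ + X)%R]addrC; congr (_ + (_ + _))%R.
  rewrite -[X in index_iota X _]add1n big_addn.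
  have -> : (2 * n).+1 - n = n.+1 by lia.
  by apply: eq_bigr => i _; rewrite PoszD addrK.
rewrite big_nat_rev/= big_add1/=; apply: eq_big_nat => i /andP[_ ilt].
by congr F; lia.
Qed.

Definition shift_in_box (k : nat) (l z : int) : bool := (`|z + l| <= k%:Z)%R.

(** The substitution x = a - l; as |l| <= 2 k, the shifted box stays within 3 k, a range that does
    not depend on l. *)
Lemma sum_int_range_shift k l (F : int -> nat) : (`|l| <= (2 * k)%:Z)%R ->
  \sum_(a <- int_range k) F (a - l)%R = \sum_(x <- int_range (3 * k)) shift_in_box k l x * F x.
Proof.
move=> lk; rewrite -(big_map (fun a => a - l)%R xpredT).
rewrite (perm_big [seq x <- int_range (3 * k) | shift_in_box k l x]); last first.
  apply: uniq_perm; rewrite ?filter_uniq ?int_range_uniq//.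
    by rewrite map_inj_uniq ?int_range_uniq//; apply: addIr.
  move=> x; rewrite mem_filter mem_int_range; apply/mapP/andP => [[a]|[h _]].
    by rewrite mem_int_range => ak ->; rewrite /shift_in_box subrK; split=> //; lia.
  by exists (x + l)%R; rewrite ?addrK// mem_int_range.
rewrite big_filter big_mkcond; apply: eq_bigr => x _.
by case: shift_in_box; rewrite ?mul1n.
Qed.

Definition sum_signs (F : int -> nat) (i : nat) : nat := F i%:Z + F (- i%:Z)%R.

Lemma sum_int_range_signs n (F : int -> nat) : F 0%R = 0 ->
  \sum_(z <- int_range n) F z = \sum_(1 <= i < n.+1) sum_signs F i.
Proof. by move=> F0; have := @sum_int_range nat n F; rewrite F0 => ->. Qed.

Lemma sum_signs_sum (I : Type) (r : seq I) (F : int -> I -> nat) i :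
  sum_signs (fun z => \sum_(j <- r) F z j) i = \sum_(j <- r) sum_signs (F^~ j) i.
Proof. by rewrite /sum_signs -big_split. Qed.

Lemma shift_in_box_signs k l j :
  sum_signs (fun x => nat_of_bool (shift_in_box k l x)) j = sign_count k `|l|%N j.
Proof. by rewrite /sum_signs /shift_in_box /sign_count; lia. Qed.

Definition signed_quad k l (b x c y : int) : nat :=
  ((b * c != 0) && (x * y == b * c))%R * (shift_in_box k l x * shift_in_box k l y).

(** For given signs of x and y the sign of bc is fixed, so two of the four sign choices for (b, c)
    remain; this is the factor 2. *)
Lemma signed_quad_signs k l i j p q : 0 < i -> 0 < j -> 0 < p -> 0 < q ->
  sum_signs (fun b => sum_signs (fun x => sum_signs (fun c => sum_signs (signed_quad k l b x c) q) p) j) i =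
  2 * quad_weight k `|l|%N i j p q.
Proof.
move=> i0 j0 p0 q0; rewrite /quad_weight -!shift_in_box_signs /sum_signs /signed_quad.
have ip : (i%:Z * p%:Z != 0)%R by rewrite -PoszM; lia.
have e1 : (j%:Z * q%:Z == i%:Z * p%:Z)%R = (i * p == j * q).
  by rewrite -!PoszM eqz_nat eq_sym.
have jq0 : 0 < j * q by rewrite muln_gt0 j0.
have ip0 : 0 < i * p by rewrite muln_gt0 i0.
have e2 : (- (j%:Z * q%:Z) == i%:Z * p%:Z)%R = false.
  by rewrite -!PoszM; move: (j * q) (i * p) jq0 ip0 => y z; lia.
have e3 : (j%:Z * q%:Z == - (i%:Z * p%:Z))%R = false.
  by rewrite -!PoszM; move: (j * q) (i * p) jq0 ip0 => y z; lia.
rewrite !(mulNr, mulrN, opprK) !oppr_eq0 !eqr_opp ip e1 e2 e3 /=.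
ring.
Qed.

Lemma sum_signed_quad k l :
  \sum_(b <- int_range k) \sum_(x <- int_range (3 * k)) \sum_(c <- int_range k)
  \sum_(y <- int_range (3 * k)) signed_quad k l b x c y = 2 * quad_sum k `|l|%N.
Proof.
have H0 b x c y : (b * c == 0)%R || (x * y == 0)%R -> signed_quad k l b x c y = 0.
  rewrite /signed_quad; case: (boolP (b * c == 0)%R) => //= bc /eqP ->.
  by rewrite eq_sym (negbTE bc).
have s0 F i : (forall z, F z = 0) -> sum_signs F i = 0 by move=> h; rewrite /sum_signs !h.
have sy b x c : \sum_(y <- int_range (3 * k)) signed_quad k l b x c y =
    \sum_(1 <= q < (3 * k).+1) sum_signs (signed_quad k l b x c) q.
  by rewrite sum_int_range_signs// H0// mulr0 eqxx orbT.
have sc b x : \sum_(c <- int_range k) \sum_(y <- int_range (3 * k)) signed_quad k l b x c y =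
    \sum_(1 <= p < k.+1) \sum_(1 <= q < (3 * k).+1)
       sum_signs (fun c => sum_signs (signed_quad k l b x c) q) p.
  rewrite (eq_bigr _ (fun c _ => sy b x c)) sum_int_range_signs; last first.
    by rewrite big1// => q _; apply: (s0) => y; rewrite H0// mulr0 eqxx.
  by apply: eq_bigr => p _; rewrite sum_signs_sum.
have sx b : \sum_(x <- int_range (3 * k)) \sum_(c <- int_range k) \sum_(y <- int_range (3 * k))
       signed_quad k l b x c y =
    \sum_(1 <= j < (3 * k).+1) \sum_(1 <= p < k.+1) \sum_(1 <= q < (3 * k).+1)
       sum_signs (fun x => sum_signs (fun c => sum_signs (signed_quad k l b x c) q) p) j.
  rewrite (eq_bigr _ (fun x _ => sc b x)) sum_int_range_signs; last first.
    rewrite big1// => p _; rewrite big1// => q _; apply: (s0) => c; apply: (s0) => y.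
    by rewrite H0// mul0r eqxx orbT.
  apply: eq_bigr => j _; rewrite sum_signs_sum; apply: eq_bigr => p _.
  by rewrite sum_signs_sum.
rewrite (eq_bigr _ (fun b _ => sx b)) sum_int_range_signs; last first.
  rewrite big1// => j _; rewrite big1// => p _; rewrite big1// => q _.
  apply: (s0) => x; apply: (s0) => c; apply: (s0) => y.
  by rewrite H0// mul0r eqxx.
rewrite /quad_sum big_distrr/=; apply: eq_big_nat => i /andP[i0 _].
rewrite sum_signs_sum big_distrr/=; apply: eq_big_nat => j /andP[j0 _].
rewrite sum_signs_sum big_distrr/=; apply: eq_big_nat => p /andP[p0 _].
rewrite sum_signs_sum big_distrr/=; apply: eq_big_nat => q /andP[q0 _].
exact: signed_quad_signs.
Qed.

Lemma count_eig_nz k l : (`|l| <= (2 * k)%:Z)%R ->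
  \sum_(a <- int_range k) \sum_(b <- int_range k) \sum_(c <- int_range k) \sum_(d <- int_range k)
    ((b * c != 0)%R && eig_eq a b c d l) = 2 * quad_sum k `|l|%N.
Proof.
move=> lk; rewrite -sum_signed_quad exchange_big/=; apply: eq_bigr => b _.
transitivity (\sum_(a <- int_range k) \sum_(c <- int_range k) \sum_(y <- int_range (3 * k))
    shift_in_box k l y * ((b * c != 0)%R && ((a - l) * y == b * c)%R)).
  apply: eq_bigr => a _; apply: eq_bigr => c _.
  exact: (sum_int_range_shift
    (fun y => nat_of_bool ((b * c != 0)%R && ((a - l) * y == b * c)%R)) lk).
rewrite (sum_int_range_shift (fun x => \sum_(c <- int_range k) \sum_(y <- int_range (3 * k))
    shift_in_box k l y * ((b * c != 0)%R && (x * y == b * c)%R)) lk).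
apply: eq_bigr => x _; rewrite big_distrr/=; apply: eq_bigr => c _.
rewrite big_distrr/=; apply: eq_bigr => y _.
by rewrite /signed_quad; ring.
Qed.

(** If bc = 0, one of b, c is 0 and one of a, d equals l: four cases, with two free entries each. *)
Lemma count_eig_z k l :
  \sum_(a <- int_range k) \sum_(b <- int_range k) \sum_(c <- int_range k) \sum_(d <- int_range k)
    ((b * c == 0)%R && eig_eq a b c d l) <= 4 * (2 * k).+1 ^ 2.
Proof.
have z0 : 0%R \in int_range k by rewrite mem_int_range normr0.
have le1 (z : int) : \sum_(x <- int_range k) (x == z) <= 1.
  by apply: sum_pred_le1; [exact: int_range_uniq|move=> ? ? _ _ /eqP -> /eqP ->].
have two (z : int) :
    \sum_(x <- int_range k) \sum_(y <- int_range k) ((x == z) + (y == z)) <= 2 * (2 * k).+1.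
  under eq_bigr do rewrite big_split/=.
  rewrite big_split/= exchange_big/= mul2n -addnn leq_add//.
    rewrite -[leqRHS]muln1 -sum_int_range_const; apply: leq_sum => y _; exact: le1.
  rewrite -[leqRHS]muln1 -sum_int_range_const; apply: leq_sum => y _; exact: le1.
apply: (@leq_trans (\sum_(a <- int_range k) \sum_(d <- int_range k) \sum_(b <- int_range k) \sum_(c <- int_range k)
   ((b == 0%R) + (c == 0%R)) * ((a == l) + (d == l)))).
  apply: leq_sum => a _.
  under eq_bigr do rewrite exchange_big/=.
  rewrite exchange_big/=; apply: leq_sum => d _; apply: leq_sum => b _.
  apply: leq_sum => c _.
  have [bc|] := eqVneq (b * c)%R 0%R => //=.
  case pr: (eig_eq a b c d l) => //.
  have /eqP := bc; rewrite mulf_eq0 => bc'.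
  move/eqP: pr; rewrite bc => /eqP; rewrite mulf_eq0 !subr_eq0 => ad.
  by rewrite muln_gt0; case/orP: bc' => ->; case/orP: ad => ->; rewrite ?addn_gt0 ?orbT.
have -> : 4 * (2 * k).+1 ^ 2 = (2 * (2 * k).+1) * (2 * (2 * k).+1) by ring.
apply: leq_trans (leq_mul (two 0%R) (two l)).
rewrite big_distrr/= leq_eqVlt; apply/orP; left; apply/eqP.
apply: eq_bigr => a _; rewrite big_distrr/=; apply: eq_bigr => d _.
by rewrite big_distrl/=; apply: eq_bigr => b _; rewrite big_distrl/=.
Qed.

(** Folding l and -l onto |l| doubles every term except that of l = 0, whence the correction by
    [quad_sum k 0]. The solutions with bc = 0 make up the error term. *)
Lemma eig_pair_count_quad_sum k :
  4 * (\sum_(0 <= l < (2 * k).+1) quad_sum k l) <= eig_pair_count k + 2 * quad_sum k 0 <=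
  4 * (\sum_(0 <= l < (2 * k).+1) quad_sum k l) + (2 * (2 * k)).+1 * (4 * (2 * k).+1 ^ 2).
Proof.
have -> : eig_pair_count k =
    \sum_(x <- int_range (2 * k)) \sum_(a <- int_range k) \sum_(b <- int_range k)
    \sum_(c <- int_range k) \sum_(d <- int_range k) eig_eq a b c d x.
  rewrite [RHS]exchange_big/=; apply: eq_bigr => a _.
  rewrite [RHS]exchange_big/=; apply: eq_bigr => b _.
  rewrite [RHS]exchange_big/=; apply: eq_bigr => c _.
  by rewrite [RHS]exchange_big.
have -> : 4 * (\sum_(0 <= l < (2 * k).+1) quad_sum k l) =
    \sum_(x <- int_range (2 * k)) 2 * quad_sum k `|x|%N + 2 * quad_sum k 0.
  have sumE (F : int -> nat) : \sum_(z <- int_range (2 * k)) F z =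
      F 0%R + \sum_(1 <= i < (2 * k).+1) (F i%:Z + F (- i%:Z)%R) := sum_int_range (2 * k) F.
  rewrite -big_distrr/= sumE absz0 (@big_ltn _ _ _ 0)//.
  under [X in _ = 2 * (_ + X) + _]eq_bigr do rewrite abszN absz_nat.
  by rewrite big_split/=; lia.
rewrite leq_add2r addnAC leq_add2r -sum_int_range_const -big_split/=.
have split x : x \in int_range (2 * k) ->
  \sum_(a <- int_range k) \sum_(b <- int_range k) \sum_(c <- int_range k) \sum_(d <- int_range k) eig_eq a b c d x =
  2 * quad_sum k `|x|%N + \sum_(a <- int_range k) \sum_(b <- int_range k) \sum_(c <- int_range k)
    \sum_(d <- int_range k) ((b * c == 0)%R && eig_eq a b c d x).
  rewrite mem_int_range => xk; rewrite -count_eig_nz// -big_split/=; apply: eq_bigr => a _.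
  rewrite -big_split/=; apply: eq_bigr => b _.
  rewrite -big_split/=; apply: eq_bigr => c _.
  rewrite -big_split/=; apply: eq_bigr => d _.
  by case: (b * c == 0)%R => /=; rewrite ?addn0 ?add0n.
apply/andP; split; rewrite big_seq [leqRHS]big_seq; apply: leq_sum => x xk.
  by rewrite split// leq_addr.
by rewrite split// leq_add2l count_eig_z.
Qed.

(** The constants: 24 = 2 * 12 from l = 0, and 234 = 180 + 54 from the solutions with bc = 0 and
    from the double eigenvalues, using 2 k + 1 <= 3 k. *)
Lemma int_eig_count_quad_sum k : 0 < k ->
  4 * (\sum_(0 <= l < (2 * k).+1) quad_sum k l) <= 2 * int_eig_count k + 24 * k ^ 3 /\
  2 * int_eig_count k <= 4 * (\sum_(0 <= l < (2 * k).+1) quad_sum k l) + 234 * k ^ 3.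
Proof.
move=> k0; have /andP[s1 s2] := eig_pair_count_quad_sum k.
have /andP[n1 n2] := int_eig_count_pairs k.
have q := quad_sum_le k 0.
split; first by lia.
have h1 : (2 * k).+1 ^ 3 <= 27 * k ^ 3 by rewrite -(expnMn 3 k 3) leq_exp2r//; lia.
have h2 : (2 * (2 * k)).+1 * (4 * (2 * k).+1 ^ 2) <= (5 * k) * (4 * (3 * k) ^ 2).
  by rewrite leq_mul// ?leq_mul// ?leq_exp2r//; lia.
have h3 : (5 * k) * (4 * (3 * k) ^ 2) = 180 * k ^ 3 by ring.
lia.
Qed.

End IntCount.

(** * From quadruples of entries to matrices *)

Section Matrices.

Lemma ncard_seq (T : choiceType) (A : set T) (s : seq T) : uniq s ->
  (forall x, A x <-> x \in s) -> ncard A = size s.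
Proof.
move=> us As; rewrite /ncard.
have -> : A = [set` [fset x in s]%fset].
  by apply/seteqP; split=> x /=; rewrite in_fset_ /= => /As.
by rewrite set_fsetK card_fseq undup_id.
Qed.

Definition mx_of_entries (t : int * int * int * int) : 'M[int]_2 :=
  \matrix_(i, j) (if i == 0 then if j == 0 then t.1.1.1 else t.1.1.2
                  else if j == 0 then t.1.2 else t.2).

Lemma mx_of_entries_eta (M : 'M[int]_2) : M = mx_of_entries (M 0 0, M 0 1, M 1 0, M 1 1).
Proof.
by apply/matrixP => i j; rewrite !mxE; case: i j => [[|[|//]] ?] [[|[|//]] ?] /=;
  congr (M _ _); apply: val_inj.
Qed.

Lemma mx_of_entries_inj : injective mx_of_entries.
Proof.
move=> [[[a b] c] d] [[[a' b'] c'] d'] /matrixP e.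
by have := (e 0 0, e 0 1, e 1 0, e 1 1); rewrite !mxE/= => -[[[-> ->] ->] ->].
Qed.

(** The eigenspace is the left kernel of M - x, nonzero iff the determinant vanishes; over [rat]
    this determinant is the image of an integer. *)
Lemma int_eigenvalue_eig_eq t x :
  int_eigenvalue (mx_of_entries t) x = eig_eq t.1.1.1 t.1.1.2 t.1.2 t.2 x.
Proof.
rewrite /int_eigenvalue /eigenvalue /= /eigenspace kermx_eq0 row_free_unit.
rewrite unitmxE unitfE negbK.
rewrite (expand_det_row _ 0) !big_ord_recl big_ord0 /cofactor !det_mx11 !mxE/=.
rewrite /bump/= !mulr1n !mulr0n !subr0 addn0 expr0 expr1 mul1r.
have -> : (t.1.1.1%:~R - x%:~R) * (t.2%:~R - x%:~R) + t.1.1.2%:~R * (-1 * t.1.2%:~R) =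
   ((t.1.1.1 - x) * (t.2 - x) - t.1.1.2 * t.1.2)%:~R :> rat.
  by rewrite !(rmorphB, rmorphM)/=; ring.
by rewrite intr_eq0 subr_eq0.
Qed.

Definition entry_box k :=
  [seq (p, d) | p <- [seq (p, c) | p <- [seq (a, b) | a <- int_range k, b <- int_range k],
   c <- int_range k], d <- int_range k].

Lemma entry_box_uniq k : uniq (entry_box k).
Proof.
have u (T : eqType) (s : seq T) : uniq s -> uniq [seq (p, d) | p <- s, d <- int_range k].
  by move=> us; apply: allpairs_uniq => //; [exact: int_range_uniq|move=> [? ?] [? ?]].
by do 3!apply: (u); exact: int_range_uniq.
Qed.

Lemma mem_entry_box k a b c d : ((a, b, c, d) \in entry_box k) =
  [&& a \in int_range k, b \in int_range k, c \in int_range k & d \in int_range k].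
Proof.
have m (T : eqType) (s : seq T) p z :
    ((p, z) \in [seq (p, d) | p <- s, d <- int_range k]) = (p \in s) && (z \in int_range k).
  by apply/allpairsPdep/andP => [[? [? [? ? [-> ->]]]]|[? ?]] //; exists p, z.
by rewrite /entry_box !m -!andbA.
Qed.

Lemma intmx2_entries k t : intmx2 k (mx_of_entries t) <-> t \in entry_box k.
Proof.
case: t => [[[a b] c] d]; rewrite mem_entry_box !mem_int_range /intmx2/=; split.
  by move=> h; have := (h 0 0, h 0 1, h 1 0, h 1 1); rewrite !mxE/= => -[[[-> ->] ->] ->].
by move=> /and4P[ha hb hc hd] i j; rewrite mxE/=; case: ifP => _; case: ifP.
Qed.

Lemma ncard_intmx2 k : ncard (intmx2 k) = ((2 * k).+1 ^ 4)%N.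
Proof.
rewrite (@ncard_seq _ _ (map mx_of_entries (entry_box k))).
- by rewrite size_map !size_allpairs !size_int_range; ring.
- by rewrite (map_inj_uniq mx_of_entries_inj) entry_box_uniq.
- move=> M; split=> [|/mapP[t tk ->]]; last exact/intmx2_entries.
  by rewrite [M]mx_of_entries_eta => /intmx2_entries h; apply: map_f.
Qed.

(** The union over all integers reduces to a search in [int_range (2 * k)], by [eig_eq_bound]. *)
Lemma ncard_intmx2_inteig k : ncard (intmx2_inteig k) = int_eig_count k.
Proof.
pose P (t : int * int * int * int) := has (eig_eq t.1.1.1 t.1.1.2 t.1.2 t.2) (int_range (2 * k)).
rewrite (@ncard_seq _ _ (map mx_of_entries [seq t <- entry_box k | P t])).
- rewrite size_map size_filter -sum1_count big_mkcond/= !big_allpairs/= /int_eig_count.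
  by do 4!(apply: eq_bigr => ? _); rewrite /P/=; case: has.
- by rewrite (map_inj_uniq mx_of_entries_inj) filter_uniq// entry_box_uniq.
- move=> M; split.
    case=> x _ []; rewrite [M]mx_of_entries_eta => /intmx2_entries hM.
    rewrite int_eigenvalue_eig_eq => px; apply: map_f; rewrite mem_filter hM andbT.
    apply/hasP; exists x => //; rewrite mem_int_range.
    move: hM; rewrite mem_entry_box !mem_int_range => /and4P[ha hb hc hd].
    exact: eig_eq_bound px.
  case/mapP=> t; rewrite mem_filter => /andP[/hasP[x _ px] tk] ->.
  exists x => //; split; first exact/intmx2_entries.
  by rewrite int_eigenvalue_eig_eq.
Qed.

End Matrices.

(** * The constant and the two asymptotic statements *)

Section Final.
Variable R : realType.

Lemma eigC_gt0 : 0 < eigC R.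
Proof.
have s0 : 0 <= Num.sqrt 2 :> R := sqrtr_ge0 _.
have L0 : 0 <= ln (Num.sqrt 2 + 1) :> R by rewrite ln_ge0// lerDr.
rewrite /eigC divr_gt0 ?mulr_gt0 ?exprn_gt0 ?pi_gt0//.
by lra.
Qed.

(** The leading 4 arises because the matrix count is about twice the sum of [quad_sum k l] over l,
    itself about 2 k^3 [coprime_J_sum R k]. *)
Lemma eigC_int_J : 4 * (int_J R / (pi ^+ 2 / 6)) = 16 * eigC R.
Proof.
rewrite /eigC /int_J; have := pi_gt0 R; move: (pi) => p p0.
by field; rewrite gt_eqF.
Qed.

Lemma int_eig_count_approx : exists2 M : R, 0 < M & forall k, (0 < k)%N ->
  `|(int_eig_count k)%:R - 16 * eigC R * k%:R ^+ 3 * ln k%:R| <= M * k%:R ^+ 3.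
Proof.
have [K HK] := coprime_J_sum_asymp R.
have K0 : 0 <= K by apply: le_trans (HK 1%N isT).
(* The errors add up to 2 * 212 + 234 / 2 = 541, rounded up to 600, plus 4 K from the coprime
   sum. *)
exists (600 + 4 * K) => [|k k0]; first by lra.
have := HK k k0; rewrite -eigC_int_J; set c := _ / _ => h1.
have k3 : 0 < k%:R ^+ 3 :> R by rewrite exprn_gt0// ltr0n.
have [q1 q2] := int_eig_count_quad_sum k0.
have h2 := sum_quad_sum_approx R k0.
have {}q1 : 4 * \sum_(0 <= l < (2 * k).+1) (quad_sum k l)%:R <=
    2 * (int_eig_count k)%:R + 24 * k%:R ^+ 3 :> R.
  by rewrite -natr_sum -natrX -!natrM -natrD ler_nat.
have {}q2 : 2 * (int_eig_count k)%:R <= 4 * \sum_(0 <= l < (2 * k).+1) (quad_sum k l)%:R +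
    234 * k%:R ^+ 3 :> R.
  by rewrite -natr_sum -natrX -!natrM -natrD ler_nat.
have h3 : `|k%:R ^+ 3 * (coprime_J_sum R k - c * ln k%:R)| <= K * k%:R ^+ 3.
  by rewrite normrM (gtr0_norm k3) mulrC ler_wpM2r// ltW.
move: h2 h3; rewrite !ler_norml => /andP[a1 a2] /andP[b1 b2].
by apply/andP; split; lra.
Qed.

End Final.

Theorem corollary2 (R : realType) :
  ((fun k : nat => fin_uniform_prob R (intmx2 k) (intmx2_inteig k)) ~_\oo
     (fun k : nat => eigC R * ln k%:R / k%:R)) /\
  ((fun k : nat => (ncard (intmx2_inteig k))%:R : R) =
     (fun k : nat => 16 * eigC R * k%:R ^+ 3 * ln k%:R) +O_\oo
     (fun k : nat => k%:R ^+ 3 : R)).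
Proof.
have [M M0 HM] := int_eig_count_approx R.
have C0 := eigC_gt0 R.
split; last first.
  apply/eqaddOP/bigO_exP; exists M => //.
  near=> k; have k0 : (0 < k)%N by near: k; exact: nbhs_infty_gt.
  rewrite !fctE ncard_intmx2_inteig [X in _ <= _ * X]ger0_norm ?exprn_ge0//.
  exact: HM.
apply/eqaddoP => e e0.
(* Once ln k >= T, the total error (M + 65 C) k^3 is at most 16 e C k^3 ln k. *)
pose T : R := (M + 65 * eigC R) / (16 * (e * eigC R)).
near=> k.
have k0 : (0 < k)%N by near: k; exact: nbhs_infty_gt.
have Tk : expR T <= k%:R by near: k; exact: nbhs_infty_ger.
have kr : 0 < k%:R :> R by rewrite ltr0n.
have k1 : 1 <= k%:R :> R by rewrite ler1n.
have TL : T <= ln k%:R by rewrite -ler_expR lnK.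
have L0 : 0 <= ln k%:R :> R by rewrite ln_ge0.
have Lk : ln k%:R <= k%:R :> R by rewrite ltW// ln_sublinear.
have hM := HM k k0.
rewrite !fctE /fin_uniform_prob.
have -> : intmx2 k `&` intmx2_inteig k = intmx2_inteig k.
  by apply/setIidPr => A [x _ []].
rewrite ncard_intmx2_inteig ncard_intmx2 natrX.
have -> : (2 * k).+1%:R = 2 * k%:R + 1 :> R by rewrite -natr1 natrM.
have g0 : 0 <= eigC R * ln k%:R / k%:R by apply: divr_ge0 => //; apply: mulr_ge0 => //; exact: ltW.
rewrite (ger0_norm g0).
rewrite /T in TL; move: hM TL C0 L0 Lk kr k1.
move: k%:R (ln k%:R) (eigC R) (int_eig_count k)%:R => n L C N hN TL C0 L0 Ln n0 n1.
set D := (2 * n + 1) ^+ 4.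
have D1 : 16 * n ^+ 4 <= D.
  rewrite -subr_ge0 (_ : _ - _ = 32 * n ^+ 3 + 24 * n ^+ 2 + 8 * n + 1); last first.
    by rewrite /D; ring.
  by rewrite !addr_ge0 ?mulr_ge0 ?exprn_ge0// ltW.
(* Here 65 = 32 + 24 + 8 + 1 collects the lower coefficients of (2 n + 1)^4, as n >= 1. *)
have D2 : D <= 16 * n ^+ 4 + 65 * n ^+ 3.
  rewrite -subr_ge0 (_ : _ - _ = (n - 1) * (33 * n ^+ 2 + 9 * n + 1)); last first.
    by rewrite /D; ring.
  by rewrite mulr_ge0 ?subr_ge0// !addr_ge0 ?mulr_ge0 ?exprn_ge0// ltW.
have n3 : 0 < n ^+ 3 by rewrite exprn_gt0.
have n4 : 0 < n ^+ 4 by rewrite exprn_gt0.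
have D0 : 0 < D by rewrite (lt_le_trans _ D1)// mulr_gt0.
have -> : N / D - C * L / n = (N - C * L * (D / n)) / D.
  by field; rewrite !gt_eqF.
rewrite normrM [X in _ * X]ger0_norm ?invr_ge0 ?(ltW D0)// ler_pdivrMr//.
have Dn1 : 16 * n ^+ 3 <= D / n by rewrite ler_pdivlMr// -mulrA -exprSr.
have Dn2 : D / n <= 16 * n ^+ 3 + 65 * n ^+ 2.
  rewrite ler_pdivrMr// (_ : (_ + _) * n = 16 * n ^+ 4 + 65 * n ^+ 3)//.
  by ring.
have CL0 : 0 <= C * L by rewrite mulr_ge0// ltW.
(* Exchanging D / n for 16 n^3 costs at most 65 C L n^2, which L <= n turns into 65 C n^3. *)
have E : `|N - C * L * (D / n)| <= (M + 65 * C) * n ^+ 3.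
  have -> : N - C * L * (D / n) =
      (N - 16 * C * n ^+ 3 * L) + (C * L) * (16 * n ^+ 3 - D / n) by ring.
  apply: le_trans (ler_normD _ _) _; rewrite [leRHS]mulrDl; apply: lerD => //.
  rewrite normrM (ger0_norm CL0) ler0_norm ?subr_le0// opprB.
  apply: (@le_trans _ _ (C * n * (65 * n ^+ 2))).
    apply: ler_pM => //; rewrite ?subr_ge0// ?lerBlDl//.
    by rewrite ler_pM2l.
  by rewrite le_eqVlt; apply/orP; left; apply/eqP; ring.
apply: le_trans E _.
have eC : 0 < e * C by rewrite mulr_gt0.
have h : M + 65 * C <= e * C * L * 16.
  by move: TL; rewrite ler_pdivrMr ?mulr_gt0//; lra.
apply: (@le_trans _ _ (e * C * L * 16 * n ^+ 3)); first by rewrite ler_pM2r.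
apply: (@le_trans _ _ (e * C * L / n * (16 * n ^+ 4))).
  by rewrite le_eqVlt; apply/orP; left; apply/eqP; field; rewrite gt_eqF.
have -> : e * (C * L / n) = e * C * L / n by rewrite !mulrA.
by apply: ler_wpM2l => //; rewrite divr_ge0 ?mulr_ge0// ltW.
Unshelve. all: by end_near. Qed.
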